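(* (a) For every sequence $u_1,\dots,u_m$ of monomials of $S$, the Taylor complex attached to $u_1,\dots,u_m$ has boundary Gröbner bases. (b) If $I\subset S$ is a monomial ideal with linear quotients with respect to the monomial generators $u_1,\dots,u_m$, then the iterated mapping cone resolution of $S/I$, formed using Koszul complexes to resolve the colon ideals, has boundary Gröbner bases. In particular, the Koszul complex attached to a regular sequence of monomials, as well as the Eliahou–Kervaire resolution of $S/I$ for a stable ideal $I$, have boundary Gröbner bases.
   Context: $K$ is a field, $S=K[x_1,\dots,x_n]$ with its standard $\mathbb{Z}^n$-grading. All bases of $\mathbb{Z}^n$-graded free modules are ordered and multihomogeneous. Initial modules: for a finitely generated $\mathbb{Z}^n$-graded free module $F$ with basis $\mathcal F=e_1,\dots,e_m$, fix a monomial order $<$ on $S$ and order monomials of $F$ by $ue_i>ve_j$ if $i<j$, or $i=j$ and $u>v$. For a multihomogeneous $z\in F$, $\operatorname{in}_{\mathcal F}(z)$ is its initial monomial ($\operatorname{in}_{\mathcal F}(0)=0$); for a $\mathbb{Z}^n$-graded submodule $N\subseteq F$, $\operatorname{in}_{\mathcal F}(N)$ is the submodule generated by the initial monomials of elements of $N$. These depend only on $\mathcal F$, not on $<$. Boundary Gröbner bases: let $\cdots\to F_1\to F_0\to M\to0$ be a $\mathbb{Z}^n$-graded free resolution with finitely generated $F_p$ and differential $\partial$; put $Z_0=\ker(F_0\to M)$ and $Z_p=\ker(\partial_p\colon F_p\to F_{p-1})$ for $p\ge1$. The resolution has boundary Gröbner bases if for each $F_p$ there is a basis $\mathcal F_p$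 such that, for all $p$, $\operatorname{in}_{\mathcal F_p}(Z_p)$ is generated by the elements $\operatorname{in}_{\mathcal F_p}(\partial_{p+1}(e))$, $e\in\mathcal F_{p+1}$. Taylor complex: for monomials $u_1,\dots,u_m$, $T_p$ is free with basis $e_F$, $F=\{i_1<\dots<i_p\}\subseteq\{1,\dots,m\}$, where $u_F=\operatorname{lcm}(u_i: i\in F)$ and $\deg e_F=\deg u_F$, with $\partial_p(e_F)=\sum_{j=1}^p(-1)^{j+1}\frac{u_F}{u_{F\setminus\{i_j\}}}e_{F\setminus\{i_j\}}$. It is a $\mathbb{Z}^n$-graded free resolution of $S/(u_1,\dots,u_m)$, and it equals the Koszul complex if $u_1,\dots,u_m$ is a regular sequence. Iterated mapping cones: let $I=(u_1,\dots,u_m)$ with monomials $u_i$, $I_j=(u_1,\dots,u_j)$, $\mathbf a_j=\deg u_j\in\mathbb{Z}^n$. Put $F^{(1)}\colon 0\to S(-\mathbf a_1)\xrightarrow{u_1}S\to S/(u_1)\to 0$. Given a resolution $F^{(j)}$ of $S/I_j$, choose a $\mathbb{Z}^n$-graded free resolution $G^{(j)}$ of $I_{j+1}/I_j\cong(S/(I_j:(u_{j+1})))(-\mathbf a_{j+1})$ and a $\mathbb{Z}^n$-graded complex homomorphism $\varphi^{(j)}\colon G^{(j)}\to F^{(j)}$ extending the inclusion $I_{j+1}/I_j\to S/I_j$; let $F^{(j+1)}$ be the mapping cone of $\varphi^{(j)}$, a resolution of $S/I_{j+1}$. Any $F^{(m)}$ so obtained is an iterated mapping cone resolution of $S/I$.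 Linear quotients: a monomial ideal $I$ has linear quotients with respect to monomial generators $u_1,\dots,u_m$ with $\deg u_1\le\dots\le\deg u_m$ if each colon ideal $L_j=(u_1,\dots,u_j):(u_{j+1})$ is generated by a subset of the variables. In this case the iterated mapping cone is formed taking for $G^{(j)}$ the (shifted) Koszul complex on the variables generating $L_j$. Stable ideals: for a monomial $u\neq1$ let $m(u)$ be the largest index $i$ with $x_i\mid u$. A monomial ideal $I$ is stable if for all monomials $u\in I$ and all $j<m(u)$, $x_j(u/x_{m(u)})\in I$. Order the minimal monomial generators $u_1,\dots,u_r$ of $I$ such that for $i<j$ either $\deg u_i<\deg u_j$, or $\deg u_i=\deg u_j$ and $u_j<u_i$ lexicographically. Then $I$ has linear quotients with respect to this sequence, and the Eliahou–Kervaire resolution of $S/I$ is the corresponding iterated mapping cone (with Koszul complexes $G^{(j)}$) for a suitable choice of the maps $\varphi^{(j)}$. *)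

(* Defs.v *)
From HB Require Import structures.
From mathcomp Require Import all_boot all_order all_algebra.
From mathcomp Require Import mpoly.

Set Implicit Arguments.
Unset Strict Implicit.
Unset Printing Implicit Defensive.

Import GRing.Theory.
Local Open Scope ring_scope.

Section Defs.
Variables (K : fieldType) (n : nat).

Local Notation S := {mpoly K[n]}.
Local Notation mon := 'X_{1..n}.

Definition Zn := {ffun 'I_n -> int}.

Definition multideg (u : mon) : Zn := [ffun k => (u k)%:Z].

Definition ideal_gen (fs : seq S) (f : S) : Prop :=
  exists c : nat -> S, f = \sum_(i < size fs) c i * fs`_i.

Definition mideal (us : seq mon) : S -> Prop :=
  ideal_gen [seq 'X_[u] | u <- us].

Definition colon (I : S -> Prop) (f : S) : S -> Prop := fun g => I (g * f).

Definition same_ideal (I J : S -> Prop) : Prop := forall f, I f <-> J f.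

(* The free S-module on the finite set I, with standard basis vectors e_b;
   a grading is a function d : I -> Zn, where d b is the degree of e_b. *)
Definition fmod (I : finType) := {ffun I -> S^o}.

Definition fbasis (I : finType) (b : I) : fmod I := [ffun c => (c == b)%:R].

Definition multihomog (I : finType) (d : I -> Zn) (z : fmod I) (a : Zn) : Prop :=
  forall (b : I) (m : mon), m \in msupp (z b) -> multideg m + d b = a.

Definition comb (I : finType) (m : nat) (E : 'I_m -> fmod I)
    (c : {ffun 'I_m -> S}) : fmod I := \sum_(i < m) c i *: E i.

Definition hom_basis (I : finType) (d : I -> Zn) (m : nat)
    (E : 'I_m -> fmod I) : Prop :=
  (forall i, exists a, multihomog d (E i) a) /\
  (forall z : fmod I, exists! c : {ffun 'I_m -> S}, z = comb E c).

Definition gen_submod (I : finType) (G : fmod I -> Prop) (z : fmod I) : Prop :=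
  exists (k : nat) (c : 'I_k -> S) (g : 'I_k -> fmod I),
    (forall i, G (g i)) /\ z = \sum_(i < k) c i *: g i.

(* The initial monomial of \sum_i c_i E_i for the position-over-term order with
   E_0 > E_1 > ... .  The monomial order on S is the degrevlex order underlying
   mlead; for multihomogeneous elements the result does not depend on it, since
   each c_i is then a scalar times a monomial. *)
Definition init_comb (I : finType) (m : nat) (E : 'I_m -> fmod I)
    (c : {ffun 'I_m -> S}) : fmod I :=
  if [pick i | (c i != 0) && [forall j : 'I_m, (j < i)%N ==> (c j == 0)]]
    is Some i then ('X_[mlead (c i)] : S) *: E i else 0.

Definition initial (I : finType) (m : nat) (E : 'I_m -> fmod I)
    (z w : fmod I) : Prop :=
  exists c : {ffun 'I_m -> S}, z = comb E c /\ w = init_comb E c.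

Definition init_submod (I : finType) (d : I -> Zn) (m : nat)
    (E : 'I_m -> fmod I) (N : fmod I -> Prop) : fmod I -> Prop :=
  gen_submod (fun w => exists z, [/\ N z, exists a, multihomog d z a & initial E z w]).

(* The S-linear map sending e_b to \sum_c f b c e_c. *)
Definition app (I J : finType) (f : I -> J -> S) (z : fmod I) : fmod J :=
  [ffun c => \sum_(b : I) z b * f b c].

Definition graded_map (I J : finType) (d : I -> Zn) (d' : J -> Zn)
    (f : I -> J -> S) : Prop :=
  forall b, multihomog d' (app f (fbasis b)) (d b).

Record gcomplex := GComplex {
  idx : nat -> finType;
  deg : forall p, idx p -> Zn;
  diff : forall p, idx p.+1 -> idx p -> S }.

Arguments deg : clear implicits.
Arguments diff : clear implicits.

(* The cycles Z_p, where M = F_0 / Z_0 is given by the submodule Z_0. *)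
Definition cycles (C : gcomplex) (Z0 : fmod (idx C 0) -> Prop) (p : nat) :
    fmod (idx C p) -> Prop :=
  match p with
  | 0 => Z0
  | q.+1 => fun z => app (diff C q) z = 0
  end.

Definition resolves (C : gcomplex) (Z0 : fmod (idx C 0) -> Prop) : Prop :=
  (forall p, graded_map (deg C p.+1) (deg C p) (diff C p)) /\
  (forall p (z : fmod (idx C p)),
     cycles Z0 z <-> exists y : fmod (idx C p.+1), z = app (diff C p) y).

Definition boundary_gb (C : gcomplex) (Z0 : fmod (idx C 0) -> Prop) : Prop :=
  exists (r : nat -> nat) (E : forall p, 'I_(r p) -> fmod (idx C p)),
    (forall p, hom_basis (deg C p) (E p)) /\
    (forall p (z : fmod (idx C p)),
       init_submod (deg C p) (E p) (@cycles C Z0 p) z <->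
       gen_submod (fun w => exists i, initial (E p) (app (diff C p) (E p.+1 i)) w) z).

(* A complex with a map F_0 -> S, e_b |-> aug b; composed with S -> S/I it is
   the augmentation of a resolution of S/I. *)
Record acomplex := AComplex {
  acx :> gcomplex;
  aug : idx acx 0 -> S }.

Arguments aug : clear implicits.

Definition aug_app (C : acomplex) (z : fmod (idx C 0)) : S :=
  \sum_(b : idx C 0) z b * aug C b.

Definition aug_ker (C : acomplex) (I : S -> Prop) (z : fmod (idx C 0)) : Prop :=
  I (aug_app z).

Definition resolves_quot (C : acomplex) (I : S -> Prop) : Prop :=
  [/\ forall b m, m \in msupp (aug C b) -> multideg m = deg C 0 b,
      exists z : fmod (idx C 0), I (aug_app z - 1)
    & resolves (@aug_ker C I)].

Definition has_boundary_gb (C : acomplex) (I : S -> Prop) : Prop :=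
  resolves_quot C I /\ boundary_gb (@aug_ker C I).

Section Simplicial.
Variable us : seq mon.

Local Notation u i := (nth 0%MM us i).

Definition subset_idx (p : nat) : finType :=
  {F : {set 'I_(size us)} | #|F| == p}.

(* The exponent j - 1 for the j-th element i of F. *)
Definition pos (m : nat) (F : {set 'I_m}) (i : 'I_m) : nat :=
  #|[set k in F | (k < i)%N]|.

Definition lcm_of (F : {set 'I_(size us)}) : mon :=
  \big[@mlcm n/0%MM]_(i in F) u i.

Definition taylor : acomplex := @AComplex
  (@GComplex subset_idx
     (fun p F => multideg (lcm_of (val F)))
     (fun p F G => \sum_(i in val F | val G == val F :\ i)
        (-1) ^+ pos (val F) i *
        'X_[(lcm_of (val F) - lcm_of (val F :\ i))%MM]))
  (fun _ => 1).

Definition koszul : acomplex := @AComplex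
  (@GComplex subset_idx
     (fun p F => \sum_(i in val F) multideg (u i))
     (fun p F G => \sum_(i in val F | val G == val F :\ i)
        (-1) ^+ pos (val F) i * 'X_[u i]))
  (fun _ => 1).

Definition regular_sequence : Prop :=
  (forall j, (j < size us)%N -> forall f : S,
     mideal (take j us) (f * 'X_[u j]) -> mideal (take j us) f) /\
  ~ mideal us 1.

End Simplicial.

Definition shift (a : mon) (C : acomplex) : gcomplex :=
  @GComplex (idx C) (fun p b => deg C p b + multideg a) (diff C).

Definition chain_map (G F : gcomplex) (phi : forall p, idx G p -> idx F p -> S) :
    Prop :=
  (forall p, graded_map (deg G p) (deg F p) (phi p)) /\
  (forall p (z : fmod (idx G p.+1)),
     app (phi p) (app (diff G p) z) = app (diff F p) (app (phi p.+1) z)).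

Section Cone.
Variables (F : acomplex) (G : gcomplex).
Variable phi : forall p, idx G p -> idx F p -> S.

Definition cone_idx (p : nat) : finType :=
  match p with
  | 0 => idx F 0
  | q.+1 => (idx F q.+1 + idx G q)%type
  end.

Definition cone_deg (p : nat) : cone_idx p -> Zn :=
  match p with
  | 0 => deg F 0
  | q.+1 => fun b => match b with
            | inl f => deg F q.+1 f
            | inr g => deg G q g
            end
  end.

Definition cone_diff (p : nat) : cone_idx p.+1 -> cone_idx p -> S :=
  match p with
  | 0 => fun b c => match b with
         | inl f => diff F 0 f c
         | inr g => phi g c
         end
  | q.+1 => fun b c => match b, c with
            | inl f, inl f' => diff F q.+1 f f'
            | inl _, inr _ => 0
            | inr g, inl f' => phi g f'
            | inr g, inr g' => - diff G q g g'
            end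
  end.

Definition cone : acomplex :=
  @AComplex (@GComplex cone_idx cone_deg cone_diff) (aug F).

End Cone.

Definition principal (u : mon) : acomplex := @AComplex
  (@GComplex (fun p => if (p < 2)%N then (unit : finType) else void)
     (fun p _ => if p is 0 then 0 else multideg u)
     (fun p _ _ => if p is 0 then 'X_[u] else 0))
  (fun _ => 1).

(* phi lifts the map S/(I : f) -> S/I that sends the class of 1 to that of f. *)
Definition lifts_inclusion (I : S -> Prop) (f : S) (F G : acomplex)
    (phi : forall p, idx G p -> idx F p -> S) : Prop :=
  forall b : idx G 0, I (aug_app (app (phi 0) (fbasis b)) - aug G b * f).

(* ch L G restricts the resolutions G allowed for the colon ideal L. *)
Inductive iterated_cone (ch : (S -> Prop) -> acomplex -> Prop) :
    seq mon -> acomplex -> Prop :=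
| IterBase u : iterated_cone ch [:: u] (principal u)
| IterStep us u (F G : acomplex) (phi : forall p, idx G p -> idx F p -> S) :
    iterated_cone ch us F ->
    resolves_quot G (colon (mideal us) 'X_[u]) ->
    ch (colon (mideal us) 'X_[u]) G ->
    @chain_map (shift u G) F phi ->
    lifts_inclusion (mideal us) 'X_[u] phi ->
    iterated_cone ch (rcons us u) (@cone F (shift u G) phi).

Definition vars (s : seq 'I_n) : seq mon := [seq U_(i)%MM | i <- s].

Definition koszul_choice (L : S -> Prop) (G : acomplex) : Prop :=
  exists s : seq 'I_n,
    [/\ uniq s, same_ideal L (mideal (vars s)) & G = koszul (vars s)].

Definition linear_quotients (I : S -> Prop) (us : seq mon) : Prop :=
  [/\ same_ideal I (mideal us),
      forall i j, (i < j < size us)%N ->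
        (mdeg (nth 0%MM us i) <= mdeg (nth 0%MM us j))%N
    & forall j, (0 < j < size us)%N -> exists s : seq 'I_n, uniq s /\
        same_ideal (colon (mideal (take j us)) 'X_[nth 0%MM us j])
                   (mideal (vars s))].

(* The index m(u), counted from 1 (so i : 'I_n is the variable of index i.+1);
   it is 0 for u = 1. *)
Definition max_index (u : mon) : nat := \max_(i < n | (0 < u i)%N) i.+1.

Definition stable (I : S -> Prop) : Prop :=
  forall (u : mon) (j k : 'I_n), I 'X_[u] -> k.+1 = max_index u -> (j < k)%N ->
    I 'X_[(U_(j) + (u - U_(k)))%MM].

Definition minimal_generators (I : S -> Prop) (us : seq mon) : Prop :=
  same_ideal I (mideal us) /\
  forall i j, (i < size us)%N -> (j < size us)%N ->
    (nth 0%MM us i <= nth 0%MM us j)%MM -> i = j.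

Definition lex_lt (v u : mon) : Prop :=
  exists k : 'I_n, (forall i : 'I_n, (i < k)%N -> v i = u i) /\ (v k < u k)%N.

Definition ek_ordered (us : seq mon) : Prop :=
  forall i j, (i < j < size us)%N ->
    let ui := nth 0%MM us i in let uj := nth 0%MM us j in
    (mdeg ui < mdeg uj)%N \/ mdeg ui = mdeg uj /\ lex_lt uj ui.

Section EliahouKervaire.
Variable us : seq mon.

Local Notation u a := (nth 0%MM us a).

(* u_a is the generator g(w) of the canonical decomposition w = g(w) y, in
   which every variable of g(w) has index at most that of every variable of y. *)
Definition canonical_gen (w : mon) (a : 'I_(size us)) : bool :=
  (u a <= w)%MM &&
  [forall k : 'I_n, forall l : 'I_n,
     (0 < u a k)%N ==> (0 < (w - u a)%MM l)%N ==> (k <= l)%N].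

Definition ek_symbol (q : nat) (x : {set 'I_n} * 'I_(size us)) : bool :=
  (#|x.1| == q) && [forall i in x.1, (i.+1 < max_index (u x.2))%N].

(* F_0 = S, and F_(q+1) has the basis e(sigma; u_a), where sigma is a set of q
   variables of index smaller than m(u_a). *)
Definition ek_idx (p : nat) : finType :=
  match p with
  | 0 => unit
  | q.+1 => {x : {set 'I_n} * 'I_(size us) | ek_symbol q x}
  end.

Definition ek_deg (p : nat) : ek_idx p -> Zn :=
  match p with
  | 0 => fun _ => 0
  | q.+1 => fun x =>
      multideg (u (val x).2) + \sum_(i in (val x).1) multideg U_(i)%MM
  end.

(* e(sigma; v) |->
     \sum_r (-1)^r x_(i_r) e(sigma \ i_r; v)
     - \sum_r (-1)^r (x_(i_r) v / g(x_(i_r) v)) e(sigma \ i_r; g(x_(i_r) v))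
   for sigma = {i_1 < ... < i_q}, where the symbols that are not admissible
   count as zero, and e(empty; v) |-> v. *)
Definition ek_diff (p : nat) : ek_idx p.+1 -> ek_idx p -> S :=
  match p with
  | 0 => fun x _ => 'X_[u (val x).2]
  | q.+1 => fun x y =>
      let: (sigma, a) := val x in let: (tau, b) := val y in
      \sum_(i in sigma | tau == sigma :\ i)
        (-1) ^+ (pos sigma i).+1 *
        ((a == b)%:R * 'X_i
         - (canonical_gen (U_(i) + u a)%MM b)%:R *
           'X_[(U_(i) + u a - u b)%MM])
  end.

Definition eliahou_kervaire : acomplex :=
  @AComplex (@GComplex ek_idx ek_deg ek_diff) (fun _ => 1).

End EliahouKervaire.

End Defs.

Arguments mideal K {n} us _.
Arguments taylor K {n} us.
Arguments koszul K {n} us.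
Arguments regular_sequence K {n} us.
Arguments koszul_choice {K n} L G.
Arguments eliahou_kervaire K {n} us.
Arguments deg {K n} g p _.
Arguments diff {K n} g p _ _.
Arguments aug {K n} a _.
Arguments cone {K n} F G phi.
Arguments shift {K n} a C.

(* Main.v *)
From HB Require Import structures.
Require Import Defs.
From mathcomp Require Import all_boot all_order all_algebra.
From mathcomp Require Import mpoly.
From mathcomp Require Import zify ring.
From Stdlib Require Import FunctionalExtensionality PropExtensionality.

(** All the resolutions in question have boundary Groebner bases given by their
    standard bases in a suitable order, and one criterion, [lead_complex], covers
    them.  It applies to a complex of multigraded free modules with [F_0 = S],
    augmented over a monomial ideal, and asks that the leading term of every
    multihomogeneous cycle be a monomial multiple of the leading term of the
    boundary of some basis element.  This is the nontrivial inclusion in the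
    definition of boundary Groebner bases.  Since dividing a multihomogeneous
    cycle by these boundaries leaves no remainder, it also yields exactness
    ([lead_complex_boundary]).  What remains is to exhibit the orders.

    Taylor complex.  Order subsets of the same size so that replacing an element
    by a larger one gives an earlier subset.  If a multihomogeneous cycle leads at
    [e_F], let [v] be the least index such that [u_v] divides the degree of the
    cycle.  Were [v] in [F], the coefficient of [e_(F \ v)] in the boundary of the
    cycle could only come from [e_F], because every other [F \ v] with [w] added
    either comes before [F] or has [w < v]; so it would not vanish.  Hence [v] is
    not in [F], it is smaller than all elements of [F], and the boundary of
    [e_(F + v)] leads at [e_F] ([taylor_lead]).  A regular sequence of monomials
    is pairwise coprime, and then the Koszul complex is the Taylor complex
    ([koszul_taylor]).

    Mapping cones.  In the cone of [phi : G -> F], put the basis of [G] before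
    that of [F].  A cycle [(f, g)] with [g <> 0] leads at the leading term of
    [g], which is a cycle of [G]; otherwise [f] is a cycle of [F].  In the lowest
    degrees the lifting condition on [phi] says that [g] maps into the colon
    ideal ([cone_lead_complex]).  The iterated cones follow by induction.

    Eliahou-Kervaire resolution.  Symbols on later generators come first, and
    symbols on the same generator are ordered as in the Taylor complex.  The map
    removing [x_i] from a symbol never leads to a later generator, so the
    component of a cycle at its latest generator is a Koszul cycle and the
    previous argument applies ([ek_lead]).  When no variable is left to remove,
    one uses instead that the canonical generator of a monomial is the first
    generator dividing it ([canonical_gen_exists]).  That the square of the
    differential is zero is checked on all symbols, admissible or not: there the
    operators removing [x_i] and [x_j] commute ([ek_coefC]), and the inadmissible
    symbols span a subcomplex ([ek_entry_admissible]). *)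

Set Implicit Arguments.
Unset Strict Implicit.
Unset Printing Implicit Defensive.
Import GRing.Theory.
Local Open Scope ring_scope.

(** * Multidegrees and homogeneous components *)

Section Monomials.
Variable n : nat.
Implicit Types u v w : 'X_{1..n}.

Lemma multideg_inj : injective (@multideg n).
Proof. by move=> u v /ffunP uv; apply/mnmP=> i; have := uv i; rewrite !ffunE => -[]. Qed.

Lemma multideg0 : multideg (0%MM : 'X_{1..n}) = 0.
Proof. by apply/ffunP=> i; rewrite !ffunE mnm0E. Qed.

Lemma multidegD u v : multideg (u + v)%MM = multideg u + multideg v.
Proof. by apply/ffunP=> i; rewrite !ffunE mnmDE PoszD. Qed.

Lemma multidegBK u v : (v <= u)%MM -> multideg (u - v)%MM + multideg v = multideg u.
Proof. by move=> vu; rewrite -multidegD submK. Qed.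

End Monomials.

Section Modules.
Variables (K : fieldType) (n : nat).
Local Notation S := {mpoly K[n]}.
Local Notation mon := 'X_{1..n}.
Implicit Types (I J : finType).

Lemma msupp_monoE (p : S) (m : mon) :
  (forall m', m' \in msupp p -> m' = m) -> p = p@_m *: 'X_[m].
Proof.
move=> h; apply/mpolyP=> k; rewrite mcoeffZ mcoeffX.
case: eqP => [<-|ne]; first by rewrite mulr1.
rewrite mulr0; apply/eqP; rewrite mcoeff_eq0; apply/negP=> /h e; exact: ne.
Qed.

(** A coefficient of a multihomogeneous element is a scalar times a monomial. *)
Lemma multihomog_mono I (d : I -> Zn n) (z : fmod K n I) a b (m : mon) :
  multihomog d z a -> m \in msupp (z b : S) -> z b = (z b : S)@_m *: 'X_[m] :> S.
Proof.
move=> hz hm; apply: msupp_monoE => m' hm'; apply: multideg_inj.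
by apply: (@addIr _ (d b)); rewrite (hz _ _ hm) (hz _ _ hm').
Qed.

Lemma app0 I J (f : I -> J -> S) : app f 0 = 0.
Proof. by apply/ffunP=> c; rewrite !ffunE big1 // => b _; rewrite ffunE mul0r. Qed.

Lemma appD I J (f : I -> J -> S) (z w : fmod K n I) : app f (z + w) = app f z + app f w.
Proof.
apply/ffunP=> c; rewrite !ffunE -big_split /=; apply: eq_bigr=> b _.
by rewrite ffunE mulrDl.
Qed.

Lemma appN I J (f : I -> J -> S) (z : fmod K n I) : app f (- z) = - app f z.
Proof. by apply/eqP; rewrite -subr_eq0 opprK -appD addNr app0. Qed.

Lemma appZ I J (f : I -> J -> S) (c : S) (z : fmod K n I) : app f (c *: z) = c *: app f z.
Proof.
apply/ffunP=> x; rewrite !ffunE; rewrite [RHS]mulr_sumr; apply: eq_bigr=> b _.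
by rewrite ffunE -mulrA.
Qed.

Lemma app_sum I J (f : I -> J -> S) (T : Type) (r : seq T) (P : pred T) (z : T -> fmod K n I) :
  app f (\sum_(i <- r | P i) z i) = \sum_(i <- r | P i) app f (z i).
Proof. exact: (big_morph _ (appD f) (app0 f)). Qed.

Lemma app_fbasis I J (f : I -> J -> S) b c : app f (fbasis K n b) c = f b c.
Proof.
rewrite ffunE (bigD1 b) //= ffunE eqxx mul1r big1 ?addr0 // => b' ne.
by rewrite ffunE (negPf ne) mul0r.
Qed.

Lemma graded_mapP I J (d : I -> Zn n) (d' : J -> Zn n) (f : I -> J -> S) :
  graded_map d d' f <->
  forall b c m, m \in msupp (f b c) -> multideg m + d' c = d b.
Proof. by split=> h b c m; have := h b c m; rewrite app_fbasis. Qed.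

Lemma multihomog_app I J (d : I -> Zn n) (d' : J -> Zn n) (f : I -> J -> S) z a :
  graded_map d d' f -> multihomog d z a -> multihomog d' (app f z) a.
Proof.
move=> /graded_mapP hf hz c m; rewrite ffunE => /msupp_sum_le.
move=> /flattenP[s /mapP[b _ ->]] /msuppM_le /allpairsP[[m1 m2] /= [h1 h2 ->]].
by rewrite multidegD -addrA (hf _ _ _ h2) (hz _ _ h1).
Qed.

Lemma multihomogD I (d : I -> Zn n) (z w : fmod K n I) a :
  multihomog d z a -> multihomog d w a -> multihomog d (z + w) a.
Proof.
move=> hz hw b m; rewrite ffunE => /msuppD_le; rewrite mem_cat => /orP[]; [exact: hz|exact: hw].
Qed.

Lemma scale_coord I (c : S) (z : fmod K n I) x : (c *: z) x = c * (z x : S).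
Proof. exact: ffunE. Qed.

Lemma sum_coord I J (c : J -> S) (z : J -> fmod K n I) x :
  (\sum_j c j *: z j) x = \sum_j c j * (z j x : S).
Proof. by rewrite sum_ffunE; apply: eq_bigr => j _; exact: scale_coord. Qed.

Lemma fmod_sum I (z : fmod K n I) : z = \sum_b (z b : S) *: fbasis K n b.
Proof.
apply/ffunP => c; rewrite [RHS]sum_coord (bigD1 c) //= ffunE eqxx mulr1.
by rewrite big1 ?addr0 // => b ne; rewrite ffunE eq_sym (negPf ne) mulr0.
Qed.

Lemma multihomog_monobasis I (d : I -> Zn n) (c : K) (m : mon) b :
  multihomog d ((c *: 'X_[m] : S) *: fbasis K n b) (multideg m + d b).
Proof.
move=> b' m'; rewrite scale_coord ffunE; case: eqP => [->|_]; last by rewrite mulr0 msupp0.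
by rewrite mulr1 => /msuppZ_le; rewrite msuppX inE => /eqP ->.
Qed.

(** The part of [z] of degree [a]. *)
Definition hcomp I (d : I -> Zn n) (a : Zn n) (z : fmod K n I) : fmod K n I :=
  [ffun b => \sum_(m <- msupp (z b : S) | multideg m + d b == a) (z b : S)@_m *: 'X_[m]].

Lemma mcoeff_hcomp I (d : I -> Zn n) a (z : fmod K n I) b m :
  (hcomp d a z b : S)@_m = if multideg m + d b == a then (z b : S)@_m else 0.
Proof.
rewrite ffunE raddf_sum /=.
have [hm|hm] := boolP (m \in msupp (z b : S)).
  rewrite big_mkcond (bigD1_seq m) ?msupp_uniq //= big1 ?addr0.
    by case: ifP => _; rewrite // mcoeffZ mcoeffX eqxx mulr1.
  by move=> k ne; case: ifP => _; rewrite // mcoeffZ mcoeffX (negPf ne) mulr0.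
rewrite big_seq_cond big1.
  by rewrite memN_msupp_eq0 // if_same.
move=> k /andP[hk _]; rewrite mcoeffZ mcoeffX; case: eqP => [e|]; last by rewrite mulr0.
by rewrite -e hk in hm.
Qed.

Lemma multihomog_hcomp I (d : I -> Zn n) a (z : fmod K n I) : multihomog d (hcomp d a z) a.
Proof. by move=> b m; rewrite mcoeff_msupp mcoeff_hcomp; case: (_ + _ =P a) => // _; rewrite eqxx. Qed.

(** The multidegrees of the terms of [z]. *)
Definition degrees I (d : I -> Zn n) (z : fmod K n I) : seq (Zn n) :=
  undup [seq multideg m + d b | b <- enum I, m <- msupp (z b : S)].

Lemma sum_hcomp I (d : I -> Zn n) (z : fmod K n I) :
  z = \sum_(a <- degrees d z) hcomp d a z.
Proof.
apply/ffunP=> b; rewrite sum_ffunE; apply/mpolyP=> m; rewrite raddf_sum /=.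
under eq_bigr do rewrite mcoeff_hcomp.
have [hm|hm] := boolP (m \in msupp (z b : S)).
  have ha : multideg m + d b \in degrees d z.
    rewrite mem_undup; by apply/allpairsPdep; exists b, m; rewrite mem_enum.
  rewrite (bigD1_seq (multideg m + d b)) ?undup_uniq //= eqxx big1 ?addr0 // => k ne.
  by rewrite eq_sym (negPf ne).
rewrite memN_msupp_eq0 // big1 // => a _; exact: if_same.
Qed.

(** The kernel of a graded map is multigraded. *)
Lemma hcomp_kernel I J (d : I -> Zn n) (d' : J -> Zn n) (f : I -> J -> S) z a :
  graded_map d d' f -> app f z = 0 -> app f (hcomp d a z) = 0.
Proof.
move=> hf; rewrite {1}(sum_hcomp d z) app_sum => /ffunP h.
apply/ffunP=> c; apply/mpolyP=> m; rewrite [in RHS]ffunE mcoeff0.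
have h0 x : multideg m + d' c <> x -> (app f (hcomp d x z) c : S)@_m = 0.
  move=> ne; apply/eqP; rewrite mcoeff_eq0; apply/negP.
  by move/(multihomog_app hf (multihomog_hcomp (d:=d) (a:=x) (z:=z)))/ne.
have [ha|ha] := boolP (a \in degrees d z); last first.
  suff -> : hcomp d a z = 0 by rewrite app0 ffunE mcoeff0.
  apply/ffunP=> b; apply/mpolyP=> k; rewrite mcoeff_hcomp ffunE mcoeff0.
  case: eqP => // e; apply: memN_msupp_eq0; apply: contra ha => hk.
  by rewrite mem_undup -e; apply/allpairsPdep; exists b, k; rewrite mem_enum.
have := congr1 (mcoeff m) (h c); rewrite sum_ffunE raddf_sum /= [in RHS]ffunE mcoeff0.
case: (multideg m + d' c =P a) => [e|]; last by move/h0.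
rewrite (bigD1_seq a) ?undup_uniq //= big1 ?addr0 // => x ne.
by apply: h0 => ex; rewrite -ex e eqxx in ne.
Qed.

(** ** Monomial ideals *)

Lemma ideal_gen0 (fs : seq S) : ideal_gen fs 0.
Proof. by exists (fun _ => 0); rewrite big1 // => i _; rewrite mul0r. Qed.

Lemma ideal_genD (fs : seq S) f g : ideal_gen fs f -> ideal_gen fs g -> ideal_gen fs (f + g).
Proof.
move=> [c ->] [c' ->]; exists (fun i => c i + c' i).
by rewrite -big_split /=; apply: eq_bigr=> i _; rewrite mulrDl.
Qed.

Lemma ideal_genM (fs : seq S) h f : ideal_gen fs f -> ideal_gen fs (h * f).
Proof.
move=> [c ->]; exists (fun i => h * c i).
by rewrite mulr_sumr; apply: eq_bigr=> i _; rewrite mulrA.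
Qed.

Lemma ideal_gen_mem (fs : seq S) f : f \in fs -> ideal_gen fs f.
Proof.
move=> hf; have hi : (index f fs < size fs)%N by rewrite index_mem.
exists (fun i => (i == index f fs)%:R); rewrite (bigD1 (Ordinal hi)) //= eqxx mul1r nth_index //.
rewrite big1 ?addr0 // => i ne; case: eqP => [e|]; rewrite ?mul0r //.
by rewrite -val_eqE /= e eqxx in ne.
Qed.

(** A monomial ideal contains exactly the polynomials all of whose monomials
    are multiples of a generator. *)
Lemma mem_mideal (us : seq mon) (f : S) :
  mideal K us f <-> forall m, m \in msupp f -> has (fun u => (u <= m)%MM) us.
Proof.
split=> [[c ->] m|h].
  move=> /msupp_sum_le /flattenP[s /mapP[i _ ->]] /msuppM_le.
  case/allpairsP=> [[m1 m2] /= [_]]; have hi : (i < size us)%N by rewrite -(size_map (fun u : mon => 'X_[u] : S)).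
  rewrite (nth_map 0%MM) // msuppX inE => /eqP -> ->.
  by apply/hasP; exists (nth 0%MM us i); rewrite ?mem_nth // lem_addl.
rewrite [f]mpolyE big_seq; elim/big_ind: _ => [||m /h]; first exact: ideal_gen0.
  exact: ideal_genD.
case/hasP=> u hu hum; rewrite -(submK hum) mpolyXD scalerAl; apply: ideal_genM.
by apply: ideal_gen_mem; exact: map_f.
Qed.

Lemma mem_midealX (us : seq mon) m :
  mideal K us ('X_[m] : S) <-> has (fun u => (u <= m)%MM) us.
Proof.
rewrite mem_mideal; split=> [->//|h k]; first by rewrite msuppX inE.
by rewrite msuppX inE => /eqP ->.
Qed.

End Modules.

(** * A criterion for boundary Groebner bases *)

Section Criterion.
Variables (K : fieldType) (n : nat).
Local Notation S := {mpoly K[n]}.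
Local Notation mon := 'X_{1..n}.

(** ** Generated submodules *)

Section GenSubmod.
Variables (I : finType) (G : fmod K n I -> Prop).

Lemma gen_submod0 : gen_submod G 0.
Proof. by exists 0%N, (fun _ => 0), (fun _ => 0); split=> [[]|]; rewrite ?big_ord0. Qed.

Lemma gen_submod_scale (c : S) g : G g -> gen_submod G (c *: g).
Proof. by move=> hg; exists 1%N, (fun _ => c), (fun _ => g); rewrite big_ord1. Qed.

Lemma gen_submodZ (c : S) z : gen_submod G z -> gen_submod G (c *: z).
Proof.
move=> [k [c' [g [hg ->]]]]; exists k, (fun i => c * c' i), g; split=> //.
by rewrite scaler_sumr; apply: eq_bigr=> i _; rewrite scalerA.
Qed.

Lemma gen_submodD z w : gen_submod G z -> gen_submod G w -> gen_submod G (z + w).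
Proof.
move=> [k [c [g [hg ->]]]] [k' [c' [g' [hg' ->]]]].
exists (k + k')%N, (fun i => match split i with inl j => c j | inr j => c' j end),
  (fun i => match split i with inl j => g j | inr j => g' j end); split.
  by move=> i; case: split.
rewrite big_split_ord /=; congr (_ + _); apply: eq_bigr=> i _.
  by rewrite (unsplitK (inl i)).
by rewrite (unsplitK (inr i)).
Qed.

End GenSubmod.

Lemma gen_submod_sub (I : finType) (G G' : fmod K n I -> Prop) z :
  (forall g, G g -> gen_submod G' g) -> gen_submod G z -> gen_submod G' z.
Proof.
move=> h [k [c [g [hg ->]]]]; elim/big_ind: _ => [||i _]; first exact: gen_submod0.
  exact: gen_submodD.
exact/gen_submodZ/h.
Qed.

(** ** Permuted standard bases *)

Section SortedEnum.
Variables (T : finType) (rho : T -> nat).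

Definition rank_sort := sort (fun x y => rho x <= rho y)%N (enum T).

(** An enumeration of [T] along which [rho] is weakly increasing. *)
Definition ranked (i : 'I_(size rank_sort)) : T := tnth (in_tuple rank_sort) i.

Lemma ranked_inj : injective ranked.
Proof. by apply/tuple_uniqP; rewrite sort_uniq enum_uniq. Qed.

Lemma ranked_surj x : {i | ranked i = x}.
Proof.
have hx : x \in rank_sort by rewrite mem_sort mem_enum.
exists (Ordinal (etrans (index_mem x _) hx)).
by rewrite /ranked (tnth_nth x) nth_index.
Qed.

Lemma ranked_mono (i j : 'I_(size rank_sort)) : (i < j)%N -> (rho (ranked i) <= rho (ranked j))%N.
Proof.
move=> ij; have x := ranked i.
rewrite /ranked !(tnth_nth x) /=.
have tr : transitive (fun x y => rho x <= rho y)%N by move=> ? ? ?; apply: leq_trans.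
by apply: (sorted_ltn_nth tr) => //; rewrite ?inE ?ltn_ord //; apply: sort_sorted => y z; apply: leq_total.
Qed.

End SortedEnum.

Section PermutedBasis.
Variables (I : finType) (d : I -> Zn n) (m : nat) (e : 'I_m -> I).
Hypotheses (e_inj : injective e) (e_surj : forall x, {i | e i = x}).

Lemma comb_fbasis (c : {ffun 'I_m -> S}) i : comb (fun i => fbasis K n (e i)) c (e i) = c i.
Proof.
rewrite [LHS]sum_coord (bigD1 i) //= ffunE eqxx mulr1 big1 ?addr0 // => j ne.
by rewrite ffunE (inj_eq e_inj) eq_sym (negPf ne) mulr0.
Qed.

Lemma comb_fbasisE (z : fmod K n I) :
  z = comb (fun i => fbasis K n (e i)) [ffun i => z (e i)].
Proof.
by apply/ffunP=> x; have [i <-] := e_surj x; rewrite comb_fbasis ffunE.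
Qed.

Lemma hom_basis_fbasis : hom_basis d (fun i => fbasis K n (e i)).
Proof.
split=> [i|z].
  exists (multideg 0%MM + d (e i)).
  have := @multihomog_monobasis K n I d 1 0%MM (e i).
  by rewrite scale1r mpolyX0 scale1r.
exists [ffun i => z (e i)]; split=> [|c ->]; first exact: comb_fbasisE.
by apply/ffunP=> i; rewrite ffunE comb_fbasis.
Qed.

Lemma initial_fbasisE (z w : fmod K n I) :
  initial (fun i => fbasis K n (e i)) z w <->
  w = init_comb (fun i => fbasis K n (e i)) [ffun i => z (e i)].
Proof.
split=> [[c [-> ->]]|->]; last by exists [ffun i => z (e i)]; split=> //; apply: comb_fbasisE.
by congr init_comb; apply/ffunP=> i; rewrite ffunE comb_fbasis.
Qed.

Lemma initial_lead (z w : fmod K n I) i :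
  z (e i) != 0 -> (forall j : 'I_m, (j < i)%N -> z (e j) = 0) ->
  initial (fun i => fbasis K n (e i)) z w <->
  w = ('X_[mlead (z (e i) : S)] : S) *: fbasis K n (e i).
Proof.
move=> zi zlt; rewrite initial_fbasisE /init_comb; case: pickP => [k|/(_ i)].
  rewrite ffunE => /andP[zk /forallP klt].
  suff <- : i = k by [].
  apply: val_inj; case: (ltngtP i k) => // h.
    by have := klt i; rewrite h ffunE (negPf zi).
  by rewrite zlt // eqxx in zk.
rewrite ffunE zi /= => /negP[]; apply/forallP=> j; apply/implyP=> ji.
by rewrite ffunE zlt.
Qed.

(** The initial monomial of a nonzero element. *)
Lemma initial_cases (z w : fmod K n I) :
  initial (fun i => fbasis K n (e i)) z w -> w = 0 \/
  exists i, [/\ z (e i) != 0, (forall j : 'I_m, (j < i)%N -> z (e j) = 0) &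
    w = ('X_[mlead (z (e i) : S)] : S) *: fbasis K n (e i)].
Proof.
rewrite initial_fbasisE /init_comb; case: pickP => [k|_]; last by left.
rewrite ffunE => /andP[zk /forallP klt] ->; right; exists k; split=> // j jk.
by have := klt j; rewrite jk ffunE => /eqP.
Qed.

End PermutedBasis.

(** ** The criterion *)

(** [lead_complex C us] says that [C] is a complex augmented over the ideal
    generated by [us], with [F_0 = S], and that its standard bases carry a rank
    such that the leading monomial of every nonzero multihomogeneous cycle is a
    multiple of the leading monomial of the boundary of a basis element.  Basis
    elements of smaller rank are larger.  The rank may have ties: they are harmless
    because the other terms of the boundary exhibited have strictly larger rank
    than its leading term. *)
Record lead_complex (C : acomplex K n) (us : seq mon) : Prop := LeadComplex {
  lc_unit : exists b0 : idx C 0,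
    [/\ forall b, b = b0, aug C b0 = 1 & deg C 0 b0 = 0];
  lc_graded : forall p, graded_map (deg C p.+1) (deg C p) (diff C p);
  lc_dd : forall p (y : fmod K n (idx C p.+1)),
    cycles (aug_ker (mideal K us)) (app (diff C p) y);
  lc_lead : exists rho : forall p, idx C p -> nat,
    forall p (z : fmod K n (idx C p)) a b,
      multihomog (deg C p) z a -> cycles (aug_ker (mideal K us)) z ->
      z b != 0 -> (forall c, (rho p c < rho p b)%N -> z c = 0) ->
      exists e : idx C p.+1, [/\ diff C p e b != 0,
        forall c, c != b -> diff C p e c != 0 -> (rho p b < rho p c)%N
        & exists2 m, m \in msupp (z b : S) & (mlead (diff C p e b) <= m)%MM] }.

Arguments lc_graded {C us} _ p.
Arguments lc_dd {C us} _ p y.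

Section Exactness.
Variables (C : acomplex K n) (us : seq mon).
Hypothesis hC : lead_complex C us.

Local Notation cyc := (cycles (aug_ker (mideal K us))).

Lemma aug_appE b0 (z : fmod K n (idx C 0)) :
  (forall b, b = b0) -> aug C b0 = 1 -> aug_app z = z b0.
Proof.
by move=> hb h1; rewrite /aug_app (bigD1 b0) //= h1 mulr1 big1 ?addr0 // => b; rewrite (hb b) eqxx.
Qed.

Lemma cyclesD p (z w : fmod K n (idx C p)) : cyc z -> cyc w -> cyc (z + w).
Proof.
case: p z w => [|p] z w /=; last by rewrite appD => -> ->; rewrite addr0.
have [b0 [hb h1 _]] := lc_unit hC.
rewrite /aug_ker !(aug_appE _ hb h1) ffunE; exact: ideal_genD.
Qed.

Lemma cyclesN p (z : fmod K n (idx C p)) : cyc z -> cyc (- z).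
Proof.
case: p z => [|p] z /=; last by rewrite appN => ->; rewrite oppr0.
have [b0 [hb h1 _]] := lc_unit hC.
rewrite /aug_ker !(aug_appE _ hb h1) ffunE -mulN1r; exact: ideal_genM.
Qed.

Lemma cycles_hcomp p a (z : fmod K n (idx C p)) : cyc z -> cyc (hcomp (deg C p) a z).
Proof.
case: p z => [|p] z /=; last exact/hcomp_kernel/(lc_graded hC p).
have [b0 [hb h1 _]] := lc_unit hC.
rewrite /aug_ker !(aug_appE _ hb h1) => /mem_mideal h; apply/mem_mideal => m.
rewrite mcoeff_msupp mcoeff_hcomp; case: (_ =P a) => _; last by rewrite eqxx.
by rewrite -mcoeff_msupp; exact: h.
Qed.

(** One division step: a multiple of the boundary of [e] cancels the coefficient
    of [z] at [b]. *)
Lemma multihomog_divide p (z : fmod K n (idx C p)) a b (e : idx C p.+1) m :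
  multihomog (deg C p) z a -> m \in msupp (z b : S) -> diff C p e b != 0 ->
  (mlead (diff C p e b) <= m)%MM ->
  exists y, [/\ multihomog (deg C p) (app (diff C p) y) a,
    app (diff C p) y b = z b
    & forall c, diff C p e c = 0 -> app (diff C p) y c = 0].
Proof.
move=> hz hm nz le; have hg := lc_graded hC p; have /graded_mapP hg' := hg.
set w := mlead _ in le; set f := diff C p e b in nz w le *.
have hw : w \in msupp f by apply: mlead_supp.
have fE : f = f@_w *: 'X_[w].
  apply: msupp_monoE => m' hm'; apply: multideg_inj.
  by apply: (@addIr _ (deg C p b)); rewrite (hg' _ _ _ hm') (hg' _ _ _ hw).
have nz' : f@_w != 0 by rewrite -mcoeff_msupp.
set c := ((z b : S)@_m / f@_w) *: 'X_[(m - w)%MM] : S.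
exists (c *: fbasis K n e); rewrite appZ; split.
- rewrite -appZ; apply: (multihomog_app hg).
  have -> : a = multideg (m - w)%MM + deg C p.+1 e.
    by rewrite -(hg' _ _ _ hw) addrA multidegBK // (hz _ _ hm).
  exact: multihomog_monobasis.
- rewrite ffunE app_fbasis -/f [RHS](multihomog_mono hz hm) fE.
  by rewrite [_ *: _]mulrC -scalerAr -scalerAl -mpolyXD [(w + _)%MM]addmC submK // scalerA divfK.
- by move=> x hx; rewrite ffunE app_fbasis hx scaler0.
Qed.

(** Such a complex is exact: the homogeneous components of a cycle are cycles, and
    division by boundaries reduces each of them to zero. *)
Lemma lead_complex_exact p (z : fmod K n (idx C p)) :
  cyc z <-> exists y : fmod K n (idx C p.+1), z = app (diff C p) y.
Proof.
split=> [hz|[y ->]]; last exact: lc_dd hC _ _.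
rewrite (sum_hcomp (deg C p) z).
suff main a (w : fmod K n (idx C p)) : multihomog (deg C p) w a -> cyc w ->
    exists y : fmod K n (idx C p.+1), w = app (diff C p) y.
  elim/big_ind: _ => [|_ _ [y ->] [y' ->]|a _].
  - by exists 0; rewrite app0.
  - by exists (y + y'); rewrite appD.
  - apply: (main a); [exact: multihomog_hcomp | exact: cycles_hcomp].
have [rho hrho] := lc_lead hC.
pose e := @ranked _ (rho p); pose r := size (rank_sort (rho p)).
(* Induction on the number k of basis elements on which w may be nonzero. *)
suff: forall k (w : fmod K n (idx C p)), (forall j : 'I_r, (j + k < r)%N -> w (e j) = 0) ->
  multihomog (deg C p) w a -> cyc w -> exists y : fmod K n (idx C p.+1), w = app (diff C p) y.
  by move/(_ r w)=> h hw wc; apply: h => // j; rewrite -[X in (_ < X)%N]add0n ltn_add2r.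
elim=> [|k IH] {}w hw wh wc.
  exists 0; rewrite app0; apply/ffunP=> x; have [i <-] := @ranked_surj _ (rho p) x.
  by rewrite ffunE; apply: hw; rewrite addn0 ltn_ord.
have [kr|kr] := leqP r k.
  by apply: IH => // j h; apply: hw; move: h; rewrite ltnNge (leq_trans kr) ?leq_addl.
have hi : (r - k.+1 < r)%N by rewrite ltn_subrL (leq_trans _ kr).
pose i := Ordinal hi.
have wlt (j : 'I_r) : (j < i)%N -> w (e j) = 0.
  by rewrite /= => h; apply: hw; lia.
have [wi|wi] := eqVneq (w (e i)) 0.
  apply: IH => // j hj; have [->//|ne] := eqVneq j i.
  by apply: wlt; move: ne; rewrite -val_eqE /=; lia.
have [|x [dx lx [m hm lem]]] := hrho p w a (e i) wh wc wi.
  move=> c; have [j <-] := @ranked_surj _ (rho p) c => h; apply: wlt.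
  rewrite ltnNge; apply/negP; rewrite leq_eqVlt => /orP[/eqP|] ij.
    by rewrite /e (val_inj ij) ltnn in h.
  by have := ranked_mono ij; rewrite leqNgt h.
have [y [yh yi yc]] := multihomog_divide wh hm dx lem.
have [||y' hy'] := IH (w - app (diff C p) y) _ _ (cyclesD wc (cyclesN (lc_dd hC _ y))).
- move=> j hj; rewrite !ffunE -/(app _ _ _).
  have [->|ne] := eqVneq j i; first by have := yi; rewrite !ffunE => ->; rewrite subrr.
  have ji : (j < i)%N by move: ne; rewrite -val_eqE /=; lia.
  rewrite wlt // sub0r; have := yc (e j); rewrite ffunE => ->; first by rewrite oppr0.
  apply/eqP/negP => /negP /lx; rewrite (inj_eq (@ranked_inj _ (rho p))) ne => /(_ isT).
  by rewrite ltnNge ranked_mono.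
- apply: multihomogD => // b m'; rewrite ffunE (perm_mem (msuppN _)); exact: yh.
by exists (y' + y); rewrite appD -hy' subrK.
Qed.

Lemma lead_complex_boundary_gb : boundary_gb (@aug_ker _ _ C (mideal K us)).
Proof.
have [rho hrho] := lc_lead hC.
exists (fun p => size (rank_sort (rho p))), (fun p i => fbasis K n (@ranked _ (rho p) i)).
have inj p := @ranked_inj _ (rho p).
split=> [p|p z]; first by apply: hom_basis_fbasis => //; apply: ranked_surj.
split; apply: gen_submod_sub => {z} w; last first.
  case=> i hw; rewrite -[w]scale1r; apply: gen_submod_scale.
  exists (app (diff C p) (fbasis K n (@ranked _ (rho p.+1) i))); split=> //.
  - exact: lc_dd hC _ _.
  - exists (deg C p.+1 (@ranked _ (rho p.+1) i)); exact: lc_graded hC _ _.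
case=> z [zc [a za]] /(initial_cases (@ranked_inj _ (rho p)) (@ranked_surj _ (rho p))).
case=> [->|[i [zi zlt ->]]]; first exact: gen_submod0.
have [|x [dx lx [m hm lem]]] := hrho p z a (ranked i) za zc zi.
  move=> c; have [j <-] := @ranked_surj _ (rho p) c => h; apply: zlt.
  rewrite ltnNge; apply/negP; rewrite leq_eqVlt => /orP[/eqP|] ij.
    by rewrite (val_inj ij) ltnn in h.
  by have := ranked_mono ij; rewrite leqNgt h.
have mE : mlead (z (ranked i) : S) = m.
  have := multihomog_mono za hm => ->; rewrite mleadZ ?mleadXm //.
  by rewrite -mcoeff_msupp.
rewrite mE -(submK lem) mpolyXD -scalerA; apply: gen_submod_scale.
have [l hl] := @ranked_surj _ (rho p.+1) x; exists l.
rewrite hl -(app_fbasis (diff C p) x).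
apply/(initial_lead (inj p) (@ranked_surj _ (rho p))) => //; first by rewrite app_fbasis.
move=> j ji; rewrite app_fbasis; apply/eqP/negP => /negP /lx.
have -> : ranked j != ranked i by rewrite (inj_eq (@ranked_inj _ (rho p))) -val_eqE neq_ltn ji.
by move/(_ isT); rewrite ltnNge ranked_mono.
Qed.

Theorem lead_complex_boundary : has_boundary_gb C (mideal K us).
Proof.
split; last exact: lead_complex_boundary_gb.
have [b0 [hb h1 hd]] := lc_unit hC; split.
- by move=> b m; rewrite (hb b) h1 hd msupp1 inE => /eqP ->; rewrite multideg0.
- exists (fbasis K n b0); rewrite (aug_appE _ hb h1) ffunE eqxx subrr; exact: ideal_gen0.
- split; [exact: lc_graded hC | exact: lead_complex_exact].
Qed.

End Exactness.
End Criterion.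

Arguments lc_graded {K n C us} _ p.
Arguments lc_dd {K n C us} _ p y.

(** * Simplicial differentials *)

Section Signs.
Variable m : nat.
Implicit Types (F : {set 'I_m}) (i j : 'I_m).

Lemma pos_setD1_gt F i j : (i < j)%N -> pos (F :\ j) i = pos F i.
Proof.
move=> ij; apply: eq_card => k; rewrite !inE; case: (k =P j) => [->|]; rewrite ?andbT //=.
by rewrite ltnNge ltnW // andbF.
Qed.

Lemma pos_setD1_lt F i j : i \in F -> (i < j)%N -> pos F j = (pos (F :\ i) j).+1.
Proof.
move=> iF ij; rewrite /pos (cardsD1 i) inE iF ij; congr _.+1.
by apply: eq_card => k; rewrite !inE andbA.
Qed.

Lemma sign_swap (R : pzRingType) F i j : i \in F -> j \in F -> i != j ->
  (-1) ^+ pos F i * (-1) ^+ pos (F :\ i) j = - ((-1) ^+ pos F j * (-1) ^+ pos (F :\ j) i) :> R.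
Proof.
wlog ij : i j / (i < j)%N => [hw|] iF jF ne.
  have [ij|ij|/val_inj e] := ltngtP i j; first exact: hw; last by rewrite e eqxx in ne.
  by rewrite [in RHS]hw ?opprK // eq_sym.
by rewrite (pos_setD1_gt F ij) (pos_setD1_lt iF ij) exprS mulN1r mulNr opprK -!exprD addnC.
Qed.

(** Removing two vertices in both orders gives opposite signs. *)
Lemma sum_sign_swap (R : pzRingType) F (h : 'I_m -> 'I_m -> R) :
  (forall i j, h i j = h j i) ->
  \sum_(i in F) (-1) ^+ pos F i * (\sum_(j in F :\ i) (-1) ^+ pos (F :\ i) j * h i j) = 0.
Proof.
move=> hC; under eq_bigr do rewrite mulr_sumr.
pose t i j := (-1) ^+ pos F i * ((-1) ^+ pos (F :\ i) j * h i j).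
have tE i j : i \in F -> j \in F -> i != j -> t i j = - t j i.
  by move=> iF jF ne; rewrite /t !mulrA (sign_swap R iF jF ne) mulNr hC.
rewrite -/(t _ _).
have -> : \sum_(i in F) \sum_(j in F :\ i) t i j =
   \sum_(i in F) \sum_(j in F | (j < i)%N) t i j + \sum_(i in F) \sum_(j in F | (i < j)%N) t i j.
  rewrite -big_split; apply: eq_bigr => i iF.
  rewrite (bigID (fun j : 'I_m => (j < i)%N)) /=; congr (_ + _); apply: eq_bigl => j.
    by rewrite !inE -val_eqE /=; case: ltngtP; rewrite ?andbT ?andbF.
  by rewrite !inE -val_eqE /=; case: ltngtP; rewrite ?andbT ?andbF.
rewrite [X in _ + X](exchange_big_dep (mem F)) /=; last by move=> i j _ /andP[].
rewrite -big_split big1 // => i iF /=.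
rewrite [X in _ + X](eq_bigl (fun j : 'I_m => (j \in F) && (j < i)%N)); last first.
  by move=> j; rewrite iF.
rewrite -big_split big1 // => j /andP[jF ji] /=.
by rewrite (tE i j) ?addNr // neq_ltn ji orbT.
Qed.

Lemma setD1_inj F i j : i \in F -> F :\ i = F :\ j -> i = j.
Proof.
move=> iF /setP /(_ i); rewrite !inE eqxx iF /= andbT => /esym /negbFE /eqP. by [].
Qed.

Lemma cards_setD1 F i k : i \in F -> #|F| == k.+1 -> #|F :\ i| == k.
Proof. by move=> iF; rewrite (cardsD1 i) iF add1n eqSS. Qed.

Lemma sum_face (V : nmodType) F i (g : 'I_m -> V) : i \in F ->
  \sum_(j in F | F :\ i == F :\ j) g j = g i.
Proof.
move=> iF; rewrite (bigD1 i) /=; last by rewrite iF eqxx.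
rewrite big1 ?addr0 // => j /andP[/andP[jF /eqP e] ne].
by rewrite (setD1_inj iF e) eqxx in ne.
Qed.

Lemma sum_faceU1 (V : nmodType) F i (g : 'I_m -> V) : i \notin F ->
  \sum_(j in i |: F | F == (i |: F) :\ j) g j = g i.
Proof.
by move=> iF; rewrite -(sum_face g (setU11 i F)); apply: eq_bigl => j; rewrite (setU1K iF).
Qed.

Lemma sum_face_neq0 (V : nmodType) F G (g : 'I_m -> V) :
  \sum_(j in F | G == F :\ j) g j != 0 -> exists2 j, j \in F & G = F :\ j.
Proof.
move=> nz; case: (pickP (fun j => (j \in F) && (G == F :\ j))) => [j /andP[jF /eqP ->]|h].
  by exists j.
by rewrite big_pred0 ?eqxx in nz.
Qed.

(** For sets of a fixed size, replacing an element by a larger one decreases the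
    weight. *)
Definition set_weight F := (\sum_(i in F) (m - i))%N.

Lemma set_weight_swap F t w : t \in F -> w \notin F ->
  (set_weight (w |: F :\ t) + (m - t) = set_weight F + (m - w))%N.
Proof.
move=> tF wF; rewrite /set_weight big_setU1 /=; last by rewrite inE (negPf wF) andbF.
rewrite [in RHS](big_setD1 t) //=; lia.
Qed.

Lemma set_weight_lt F t w : t \in F -> w \notin F -> (t < w)%N ->
  (set_weight (w |: F :\ t) < set_weight F)%N.
Proof. move=> tF wF tw; have := set_weight_swap tF wF; have := ltn_ord w; lia. Qed.

Lemma set_weight_gt F t w : t \in F -> w \notin F -> (w < t)%N ->
  (set_weight F < set_weight (w |: F :\ t))%N.
Proof. move=> tF wF tw; have := set_weight_swap tF wF; have := ltn_ord t; lia. Qed.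

End Signs.

Section Composition.
Variables (K : fieldType) (n : nat).
Local Notation S := {mpoly K[n]}.

Lemma app_app_eq0 (I J L : finType) (f : I -> J -> S) (g : J -> L -> S) :
  (forall a c, \sum_b f a b * g b c = 0) -> forall y : fmod K n I, app g (app f y) = 0.
Proof.
move=> h y; apply/ffunP=> c; rewrite !ffunE; under eq_bigr do rewrite ffunE mulr_suml.
rewrite exchange_big big1 //= => a _.
by under eq_bigr do rewrite -mulrA; rewrite -mulr_sumr h mulr0.
Qed.

Lemma app_single (I J : finType) (f : I -> J -> S) (z : fmod K n I) b c :
  (forall b', b' != b -> z b' != 0 -> f b' c = 0) -> app f z c = z b * f b c.
Proof.
move=> h; rewrite ffunE (bigD1 b) //= big1 ?addr0 // => b' ne.
by have [->|nz] := eqVneq (z b') 0; rewrite ?mul0r // h // mulr0.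
Qed.

Lemma sum_sig (V : nmodType) (T : finType) (P : pred T) (g : T -> V) :
  \sum_(b : {x | P x}) g (val b) = \sum_(x | P x) g x.
Proof.
rewrite (reindex_omap (val : {x | P x} -> T) insub) /=; last first.
  by move=> x Px; rewrite insubT.
by apply: eq_bigl => b; rewrite valK eqxx andbT (valP b).
Qed.

Lemma signX_neq0 k (w : 'X_{1..n}) : (-1) ^+ k * 'X_[w] != 0 :> S.
Proof.
rewrite -signr_odd mulr_sign; case: ifP => _; rewrite ?oppr_eq0;
  by apply/eqP => /(congr1 (mcoeff w)) /eqP; rewrite mcoeffX mcoeff0 eqxx oner_eq0.
Qed.

Lemma mlead_signX k (w : 'X_{1..n}) : mlead ((-1) ^+ k * 'X_[w] : S) = w.
Proof. by rewrite -signr_odd mulr_sign; case: ifP => _; rewrite ?mleadN mleadXm. Qed.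

Lemma msupp_signX k (w m : 'X_{1..n}) : m \in msupp ((-1) ^+ k * 'X_[w] : S) -> m = w.
Proof.
by rewrite -signr_odd mulr_sign; case: ifP => _;
   rewrite ?(perm_mem (msuppN _)) msuppX inE => /eqP.
Qed.

End Composition.

(** * The Taylor complex *)

Lemma submD_telescope n (u v w : 'X_{1..n}) :
  (v <= u)%MM -> (w <= v)%MM -> ((u - v) + (v - w) = u - w)%MM.
Proof.
move=> /mnm_lepP vu /mnm_lepP wv; apply/mnmP => i; rewrite mnmDE !mnmBE.
have := vu i; have := wv i; lia.
Qed.

Lemma submn_le n (u v w : 'X_{1..n}) : (u <= w + v)%MM -> (u - v <= w)%MM.
Proof.
by move=> /mnm_lepP h; apply/mnm_lepP => i; have := h i; rewrite mnmBE mnmDE; lia.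
Qed.

Lemma mlcmA n : associative (@mlcm n).
Proof. by move=> u v w; apply/mnmP => i; rewrite /mlcm !mnmE maxnA. Qed.

HB.instance Definition _ n :=
  Monoid.isComLaw.Build 'X_{1..n} 0%MM (@mlcm n) (@mlcmA n) (@mlcmC n) (@mlc0m n).

Section Taylor.
Variables (K : fieldType) (n : nat) (us : seq 'X_{1..n}).
Local Notation S := {mpoly K[n]}.
Local Notation u i := (nth 0%MM us i).
Local Notation T := (taylor K us).
Implicit Types F G : {set 'I_(size us)}.

Lemma lcm_of_setU1 i F : i \notin F -> lcm_of (i |: F) = mlcm (u i) (lcm_of F).
Proof. by move=> iF; rewrite /lcm_of big_setU1. Qed.

Lemma lcm_of_setD1 i F : i \in F -> lcm_of F = mlcm (u i) (lcm_of (F :\ i)).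
Proof. by move=> iF; rewrite /lcm_of (big_setD1 i). Qed.

Lemma lcm_of_sub i F : (lcm_of (F :\ i) <= lcm_of F)%MM.
Proof.
case: (boolP (i \in F)) => iF; first by rewrite (lcm_of_setD1 iF) lem_mlcmr.
suff -> : F :\ i = F by apply: lepm_refl.
by apply/setP => j; rewrite !inE; case: eqP => [->|//]; rewrite (negPf iF).
Qed.

Lemma taylor_dd p (a : subset_idx us p.+2) (c : subset_idx us p) :
  \sum_b diff T p.+1 a b * diff T p b c = 0.
Proof.
case: a c => [F /= hF] [G hG]; rewrite /taylor /=.
pose B (H : {set 'I_(size us)}) := \sum_(j in H | G == H :\ j) (-1) ^+ pos H j * 'X_[(lcm_of H - lcm_of (H :\ j))%MM] : S.
rewrite (sum_sig (fun H : {set 'I_(size us)} => #|H| == p.+1)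
  (fun H : {set 'I_(size us)} => (\sum_(i in F | H == F :\ i) (-1) ^+ pos F i * 'X_[(lcm_of F - lcm_of (F :\ i))%MM]) * B H)).
under eq_bigr do rewrite mulr_suml.
rewrite (exchange_big_dep (mem F)) /=; last by move=> ? ? _ /andP[].
have hDi i : i \in F -> #|F :\ i| == p.+1.
  by move=> iF; exact: cards_setD1.
rewrite -[RHS](@sum_sign_swap _ S F
   (fun i j => (G == F :\ i :\ j)%:R * 'X_[(lcm_of F - lcm_of (F :\ i :\ j))%MM])); last first.
  by move=> i j; have -> : F :\ i :\ j = F :\ j :\ i by apply/setP => k; rewrite !inE andbCA.
apply: eq_bigr => i iF.
rewrite (big_pred1 (F :\ i)) => [|H]; last first.
  by rewrite iF /=; case: (H =P F :\ i) => [->|]; rewrite ?hDi ?andbF ?andbT.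
rewrite -mulrA; congr (_ * _); rewrite mulr_sumr big_mkcondr; apply: eq_bigr => j jF.
case: eqP => _; rewrite ?mul0r ?mulr0 // mul1r mulrCA -mpolyXD.
by rewrite submD_telescope ?lcm_of_sub.
Qed.

Lemma taylor_graded p : graded_map (deg T p.+1) (deg T p) (diff T p).
Proof.
apply/graded_mapP => -[F hF] [G hG] m /= /msupp_sum_le /flattenP[s /mapP[i]].
rewrite mem_filter => /andP[/andP[iF /eqP ->] _] -> /msupp_signX ->.
by rewrite multidegBK // lcm_of_sub.
Qed.

(** The boundary exhibited is that of [e_(v |: F)], where [v] is smaller than all
    elements of [F] and [u_v] divides the degree of the cycle. *)
Lemma taylor_lead p (z : fmod K n (subset_idx us p)) a b :
  multihomog (deg T p) z a -> cycles (@aug_ker _ _ T (mideal K us)) z -> z b != 0 ->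
  (forall c : subset_idx us p, (set_weight (val c) < set_weight (val b))%N -> z c = 0) ->
  exists e : subset_idx us p.+1, [/\ diff T p e b != 0,
        forall c, c != b -> diff T p e c != 0 -> (set_weight (val b) < set_weight (val c))%N
        & exists2 m, m \in msupp (z b : S) & (mlead (diff T p e b) <= m)%MM].
Proof.
case: b => F hF hz zc zb zlt; set b := exist _ F hF in zb zlt *.
set m := mlead (z b : S); have hm : m \in msupp (z b : S) by apply: mlead_supp.
(* [m + lcm_of F] is the degree of the cycle. *)
case: (pickP (fun v : 'I_(size us) => (u v <= m + lcm_of F)%MM && [forall t in F, (v < t)%N])).
  move=> v /andP[vm /forallP vF].
  have vlt t : t \in F -> (v < t)%N by move: (vF t) => /implyP.
  have vNF : v \notin F by apply/negP => /vlt; rewrite ltnn.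
  have he : #|v |: F| == p.+1 by rewrite cardsU1 vNF (eqP hF).
  have dE : diff T p (exist _ (v |: F) he) b = (-1) ^+ pos (v |: F) v * 'X_[(lcm_of (v |: F) - lcm_of F)%MM].
    by rewrite /= (sum_faceU1 _ vNF) setU1K.
  exists (exist _ (v |: F) he); rewrite dE; split; first exact: signX_neq0.
    move=> [G hG] /= ne /sum_face_neq0[i].
    rewrite !inE => /orP[/eqP ->|iF] GE; first by rewrite -val_eqE /= GE setU1K ?eqxx in ne.
    have iv : i != v by apply: contraNneq vNF => <-.
    have -> : G = v |: F :\ i.
      by rewrite GE; apply/setP => k; rewrite !inE; case: (k =P v) => [->|]; rewrite //= eq_sym iv.
    by apply: set_weight_gt => //; apply: vlt.
  exists m => //; rewrite mlead_signX lcm_of_setU1 //.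
  by apply: submn_le; rewrite lem_mlcm vm lem_addl.
move=> none; exfalso.
have none' (v : 'I_(size us)) : (u v <= m + lcm_of F)%MM -> exists2 t : 'I_(size us), t \in F & (t <= v)%N.
  move=> h; have := none v; rewrite h /= => /negbT; rewrite negb_forall => /existsP[t].
  by rewrite negb_imply -leqNgt => /andP[]; exists t.
case: p => [|p] in z hF b hz zc zb zlt m hm none none' *.
  have F0 : F = set0 by apply/eqP; rewrite -cards_eq0.
  move: zc; rewrite /= /aug_ker (@aug_appE _ _ T b) //; last first.
    by move=> [G hG]; apply: val_inj; rewrite /= F0; apply/eqP; rewrite -cards_eq0.
  move=> /mem_mideal /(_ m hm) /hasP[w /(nthP 0%MM)[i hi <-]] wm.
  have [|t] := none' (Ordinal hi); first by rewrite (lepm_trans wm) ?lem_addr.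
  by rewrite F0 inE.
have [t0 t0F] : exists t, t \in F by apply/card_gt0P; rewrite (eqP hF).
case: (arg_minnP (fun i : 'I_(size us) => i : nat) t0F) => t /= tF tmin; change (is_true (t \in F)) in tF.
have hG : #|F :\ t| == p by exact: cards_setD1.
pose G : subset_idx us p := exist _ (F :\ t) hG.
(* Without such a v, only F contributes to the coefficient at F minus its least
   element t, which therefore does not vanish. *)
have : app (diff T p) z G = 0 by rewrite zc ffunE.
rewrite (@app_single _ _ _ _ _ _ b) /=.
  rewrite sum_face // => /eqP; rewrite mulf_eq0 (negPf zb) /=; apply/negP; exact: signX_neq0.
move=> [H hH] ne zH; apply/eqP/negP => /negP /sum_face_neq0[w wH] GE.
have wG : w \notin F :\ t by rewrite GE !inE eqxx.
have HE : H = w |: F :\ t by rewrite GE setD1K.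
have wF : w \notin F.
  apply: contra ne => wF; apply/eqP/val_inj; rewrite /= HE.
  by move: wG; rewrite !inE wF andbT negbK => /eqP ->; rewrite setD1K.
have [tw|wt|/val_inj e] := ltngtP t w; last by rewrite -e tF in wF.
  by rewrite zlt ?eqxx //= in zH; rewrite HE set_weight_lt.
have [|t' t'F] := none' w; last by rewrite leqNgt (leq_trans wt) // tmin.
have hm' := mlead_supp zH; set m' := mlead _ in hm'.
have : (m' + lcm_of H = m + lcm_of F)%MM.
  by apply: multideg_inj; rewrite !multidegD (hz _ _ hm') (hz _ _ hm).
move=> <-; apply: lepm_trans (lem_addl _ _).
by rewrite (lcm_of_setD1 wH) lem_mlcml.
Qed.

Lemma taylor_lead_complex : lead_complex T us.
Proof.
split; last by exists (fun p (F : subset_idx us p) => set_weight (val F)); exact: taylor_lead.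
- have h0 : #|set0 : {set 'I_(size us)}| == 0%N by rewrite cards0.
  exists (exist _ set0 h0); split=> //.
    by move=> [G hG]; apply: val_inj; rewrite /=; apply/eqP; rewrite -cards_eq0.
  by rewrite /= /lcm_of big_set0 multideg0.
- exact: taylor_graded.
case=> [|p] y /=; last exact/app_app_eq0/taylor_dd.
rewrite /aug_ker /aug_app; elim/big_ind: _ => [||G _]; [exact: ideal_gen0|exact: ideal_genD|].
rewrite mulr1 ffunE; elim/big_ind: _ => [||F _]; [exact: ideal_gen0|exact: ideal_genD|].
apply: ideal_genM; elim/big_ind: _ => [||i /andP[iF /eqP GE]]; [exact: ideal_gen0|exact: ideal_genD|].
apply: ideal_genM; apply/mem_midealX/hasP; exists (u i); first exact: mem_nth.
have F1 : val F :\ i = set0 by apply/eqP; rewrite -cards_eq0 -GE (eqP (valP G)).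
rewrite (lcm_of_setD1 iF) F1 /lcm_of big_set0 mlcm0; apply/mnm_lepP => k.
by rewrite mnmBE mnm0E subn0.
Qed.

End Taylor.

(** * The Koszul complex on pairwise coprime monomials *)

Section Koszul.
Variables (K : fieldType) (n : nat).

(** No variable divides two distinct members of the sequence. *)
Definition pairwise_coprime (us : seq 'X_{1..n}) := forall i j k,
  (i < j < size us)%N -> (0 < nth 0%MM us i k)%N -> (0 < nth 0%MM us j k)%N -> False.

Section Coprime.
Variable us : seq 'X_{1..n}.
Hypothesis us_coprime : pairwise_coprime us.
Local Notation u i := (nth 0%MM us i).

Lemma lcm_of_coprime (F : {set 'I_(size us)}) : lcm_of F = (\sum_(i in F) u i)%MM.
Proof.
apply/mnmP => k; rewrite mnm_sumE /lcm_of.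
rewrite (big_morph (fun w : 'X_{1..n} => w k) (id1 := 0%N) (op1 := maxn)); last 2 first.
- by move=> v w; rewrite mnmE.
- by rewrite mnm0E.
case: (pickP (fun i => (i \in F) && (0 < u i k)%N)) => [i /andP[iF ik]|none].
  have h0 j : (j \in F) && (j != i) -> u j k = 0%N.
    move=> /andP[jF ne]; apply/eqP; rewrite -leqn0 leqNgt; apply/negP => jk.
    move: ne; rewrite -val_eqE neq_ltn => /orP[] ij.
      by apply: (us_coprime _ jk ik); rewrite ij ltn_ord.
    by apply: (us_coprime _ ik jk); rewrite ij ltn_ord.
  by rewrite (bigD1 i) // [RHS](bigD1 i) //= !big1 // maxn0 addn0.
by rewrite !big1 // => i iF; have := none i; rewrite iF /= lt0n => /negbFE /eqP.
Qed.

Lemma acomplex_ext (ix : nat -> finType) (d d' : forall p, ix p -> Zn n)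
    (f f' : forall p, ix p.+1 -> ix p -> {mpoly K[n]}) (a : ix 0%N -> {mpoly K[n]}) :
  (forall p x, d p x = d' p x) -> (forall p x y, f p x y = f' p x y) ->
  @AComplex K n (GComplex d f) a = @AComplex K n (GComplex d' f') a.
Proof.
move=> hd hf; have -> : d = d'.
  by apply: functional_extensionality_dep => p; apply: functional_extensionality_dep.
suff -> : f = f' by [].
apply: functional_extensionality_dep => p; apply: functional_extensionality_dep => x.
exact: functional_extensionality_dep.
Qed.

Lemma koszul_taylor : koszul K us = taylor K us.
Proof.
apply: acomplex_ext => [p F|p F G].
  by rewrite lcm_of_coprime (big_morph _ (@multidegD n) (@multideg0 n)).
apply: eq_bigr => i /andP[iF _].
congr (_ * 'X_[_]); rewrite !lcm_of_coprime (big_setD1 i) //=.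
by apply/mnmP => k; rewrite mnmBE mnmDE addnK.
Qed.

End Coprime.

Lemma vars_coprime (s : seq 'I_n) : uniq s -> pairwise_coprime (vars s).
Proof.
move=> us i j k; rewrite size_map => /andP[ij js].
rewrite !(nth_map k) ?(ltn_trans ij) // !mnm1E.
case: eqP => // ei; case: eqP => // ej _ _.
by have := nth_uniq k (ltn_trans ij js) js us; rewrite ei ej eqxx ltn_eqF.
Qed.

(** A regular sequence of monomials is pairwise coprime.  If [u_i] and [u_j] with
    [i < j] share a variable [x], then [(u_i / x) u_j] is a multiple of [u_i], so
    some [u_h] with [h < j] divides [u_i / x].  Then [h <> i], and [u_h] is coprime
    to [u_i] by induction on [j]; so [u_h = 1], which is excluded. *)
Lemma regular_coprime (us : seq 'X_{1..n}) : regular_sequence K us -> pairwise_coprime us.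
Proof.
case=> reg no1 i j; elim/ltn_ind: j i => j IH i k /andP[ij js] ik jk.
have mono l (v : 'X_{1..n}) : (l <= size us)%N -> has (fun w => (w <= v)%MM) (take l us) ->
    exists2 h, (h < l)%N & (nth 0%MM us h <= v)%MM.
  move=> ls /(has_nthP 0%MM)[h]; rewrite size_take_min => hh; have hl : (h < l)%N by lia.
  by rewrite nth_take //; exists h.
have n0 h : (h < size us)%N -> nth 0%MM us h != 0%MM.
  move=> hs; apply/eqP => e; apply: no1; rewrite -mpolyX0; apply/mem_midealX/hasP.
  by exists (nth 0%MM us h); rewrite ?mem_nth // e lepm_refl.
have step h (w : 'X_{1..n}) : (h < size us)%N ->
    has (fun v => (v <= w + nth 0%MM us h)%MM) (take h us) -> has (fun v => (v <= w)%MM) (take h us).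
  move=> hs hw; apply/(mem_midealX K)/(reg h hs); rewrite -mpolyXD; exact/mem_midealX.
have is_ := ltn_trans ij js.
have [] := mono j (nth 0%MM us i - U_(k))%MM (ltnW js).
  apply: step => //; apply/hasP; exists (nth 0%MM us i).
    by rewrite -[nth _ _ i](nth_take _ ij) mem_nth // size_take js.
  apply/mnm_lepP => l; rewrite mnmDE mnmBE mnm1E; case: (k =P l) => [<-|]; lia.
move=> h hj hi.
have hi' : (nth 0%MM us h <= nth 0%MM us i)%MM by apply: lepm_trans hi (lem_subr _ _).
have hs := ltn_trans hj js.
have /existsP[l hl] : [exists l, (0 < nth 0%MM us h l)%N].
  apply: contraNT (n0 h hs); rewrite negb_exists => /forallP h0; apply/eqP/mnmP => l.
  by rewrite mnm0E; have := h0 l; rewrite -leqNgt leqn0 => /eqP.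
have il : (0 < nth 0%MM us i l)%N by move/mnm_lepP: hi' => /(_ l); lia.
have [hi_|hi_|e] := ltngtP h i; last first.
- move/mnm_lepP: hi => /(_ k); rewrite e mnmBE mnm1E eqxx; lia.
- by apply: (IH h hj i l _ il hl); rewrite hi_ hs.
- by apply: (IH i ij h l _ hl il); rewrite hi_ is_.
Qed.

End Koszul.

(** * Mapping cones *)

Section Aug.
Variables (K : fieldType) (n : nat) (C : acomplex K n).
Local Notation S := {mpoly K[n]}.
Implicit Types z w : fmod K n (idx C 0).

Lemma aug_appD z w : aug_app (z + w) = aug_app z + aug_app w.
Proof. by rewrite /aug_app -big_split; apply: eq_bigr => b _; rewrite ffunE mulrDl. Qed.

Lemma aug_appZ (c : S) z : aug_app (c *: z) = c * aug_app z.
Proof. by rewrite /aug_app mulr_sumr; apply: eq_bigr => b _; rewrite ffunE -mulrA. Qed.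

Lemma aug_app0 : aug_app (0 : fmod K n (idx C 0)) = 0.
Proof. by rewrite -(scale0r 0) aug_appZ mul0r. Qed.

Lemma aug_app_fbasis b : aug_app (fbasis K n b : fmod K n (idx C 0)) = aug C b.
Proof.
rewrite /aug_app (bigD1 b) //= ffunE eqxx mul1r big1 ?addr0 // => c ne.
by rewrite ffunE (negPf ne) mul0r.
Qed.

End Aug.

Section Cone.
Variables (K : fieldType) (n : nat).
Local Notation S := {mpoly K[n]}.
Variables (us vs : seq 'X_{1..n}) (u : 'X_{1..n}) (F G : acomplex K n).
Variable phi : forall p, idx G p -> idx F p -> S.
Hypotheses (hF : lead_complex F us) (hG : lead_complex G vs).
Hypothesis hL : same_ideal (colon (mideal K us) 'X_[u]) (mideal K vs).
Hypothesis hphi : @chain_map K n (shift u G) F phi.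
Hypothesis hlift : lifts_inclusion (mideal K us) 'X_[u] phi.

Local Notation C := (@cone K n F (shift u G) phi).

(** The two components of an element of a direct sum. *)
Definition lpart (I J : finType) (z : fmod K n (I + J)%type) : fmod K n I :=
  [ffun f => z (inl f)].
Definition rpart (I J : finType) (z : fmod K n (I + J)%type) : fmod K n J :=
  [ffun g => z (inr g)].

Lemma cone_app0 z : app (diff C 0) z = app (diff F 0) (lpart z) + app (phi (p:=0)) (rpart z).
Proof.
apply/ffunP => c; rewrite !ffunE big_sumType /=.
by congr (_ + _); apply: eq_bigr => i _; rewrite ffunE.
Qed.

Lemma cone_appl q z :
  lpart (app (diff C q.+1) z) = app (diff F q.+1) (lpart z) + app (phi (p:=q.+1)) (rpart z).
Proof.
apply/ffunP => c; rewrite !ffunE big_sumType /=.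
by congr (_ + _); apply: eq_bigr => i _; rewrite ffunE.
Qed.

Lemma cone_appr q z : rpart (app (diff C q.+1) z) = - app (diff G q) (rpart z).
Proof.
apply/ffunP => c; rewrite !ffunE big_sumType /= big1 ?add0r => [|i _]; last by rewrite mulr0.
by rewrite -sumrN; apply: eq_bigr => i _; rewrite ffunE mulrN.
Qed.

Lemma chain_commute p (z : fmod K n (idx G p.+1)) :
  app (phi (p:=p)) (app (diff G p) z) = app (diff F p) (app (phi (p:=p.+1)) z).
Proof. by case: hphi => _ /(_ p z). Qed.

Lemma mideal_rcons f : mideal K us f -> mideal K (rcons us u) f.
Proof.
by move=> /mem_mideal h; apply/mem_mideal => m /h; rewrite has_rcons orbC => ->.
Qed.

(** On [G_0], [phi] followed by the augmentation of [F] is multiplication of the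
    augmentation of [G] by [u], modulo the ideal. *)
Lemma lifts_aug z : mideal K us (aug_app (app (phi (p:=0)) z) - aug_app z * 'X_[u]).
Proof.
rewrite [z]fmod_sum; elim/big_ind: _ => [|w w' h h'|b _].
- by rewrite app0 !aug_app0 mul0r subrr; exact: ideal_gen0.
- by rewrite appD !aug_appD mulrDl opprD addrACA; apply: ideal_genD.
- by rewrite appZ !aug_appZ aug_app_fbasis -mulrA -mulrBr; apply/ideal_genM/hlift.
Qed.

Lemma cone_dd p (y : fmod K n (idx C p.+1)) :
  cycles (@aug_ker _ _ C (mideal K (rcons us u))) (app (diff C p) y).
Proof.
case: p y => [|[|p]] y.
- change (mideal K (rcons us u) (@aug_app K n F (app (diff C 0) y))).
  rewrite cone_app0 aug_appD; apply: ideal_genD.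
    apply: mideal_rcons; exact: (lc_dd hF 0 (lpart y)).
  rewrite -(subrK (aug_app (rpart y) * 'X_[u]) (aug_app _)); apply: ideal_genD.
    exact/mideal_rcons/lifts_aug.
  by apply/ideal_genM/mem_midealX; rewrite has_rcons lepm_refl.
- rewrite /= cone_app0 cone_appl cone_appr appD appN chain_commute addrK.
  exact: (lc_dd hF 1 (lpart y)).
- have hl := cone_appl (app (diff C p.+2) y).
  rewrite [in RHS]cone_appl [in RHS]cone_appr appD appN chain_commute addrK in hl.
  rewrite [in RHS](lc_dd hF p.+2 (lpart y)) in hl.
  have hr := cone_appr (app (diff C p.+2) y).
  rewrite [in RHS]cone_appr appN opprK [in RHS](lc_dd hG p.+1 (rpart y)) in hr.
  apply/ffunP => -[c|c]; rewrite [RHS]ffunE.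
    by have /ffunP/(_ c) := hl; rewrite !ffunE.
  by have /ffunP/(_ c) := hr; rewrite !ffunE.
Qed.

Lemma cone_graded p : graded_map (deg C p.+1) (deg C p) (diff C p).
Proof.
have hf q := iffLR (graded_mapP _ _ _) (lc_graded hF q).
have hg q := iffLR (graded_mapP _ _ _) (lc_graded hG q).
have hp q := iffLR (graded_mapP _ _ _) (hphi.1 q).
apply/graded_mapP; case: p => [|p] [b|b]; [exact: hf|exact: hp| |].
  by case=> c m /=; [exact: hf|rewrite msupp0].
case=> c m /=; first exact: hp.
by rewrite (perm_mem (msuppN _)) => /hg <-; rewrite addrA.
Qed.

Section Lead.
Variables (rhoF : forall p, idx F p -> nat) (rhoG : forall p, idx G p -> nat).

(** In the cone the basis elements of the second summand come first. *)
Definition cone_rank (p : nat) : idx C p -> nat :=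
  match p return idx C p -> nat with
  | 0 => @rhoF 0
  | q.+1 => fun b => match b with
      | inl f => ((\sum_g @rhoG q g).+1 + @rhoF q.+1 f)%N
      | inr g => @rhoG q g
      end
  end.

Lemma cone_rank_lt q (f : idx F q.+1) (g : idx G q) :
  (@cone_rank q.+1 (inr g) < @cone_rank q.+1 (inl f))%N.
Proof. by rewrite /= (bigD1 g) //= addSn ltnS -addnA leq_addr. Qed.

Local Notation lead_property X I rho := (forall p (z : fmod K n (idx X p)) a b,
  multihomog (deg X p) z a -> cycles (@aug_ker _ _ X (mideal K I)) z ->
  z b != 0 -> (forall c, (rho p c < rho p b)%N -> z c = 0) ->
  exists e : idx X p.+1, [/\ diff X p e b != 0,
    forall c, c != b -> diff X p e c != 0 -> (rho p b < rho p c)%N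
    & exists2 m, m \in msupp (z b : S) & (mlead (diff X p e b) <= m)%MM]).

Hypotheses (rhoFP : lead_property F us rhoF) (rhoGP : lead_property G vs rhoG).

(** In homological degree 0, a multiple of [u] outside the ideal generated by [us]
    is reached by the generator of [G_0], which [phi] sends to [u] itself. *)
Lemma cone_lead0 (z : fmod K n (idx F 0)) a b :
  multihomog (deg F 0) z a -> mideal K (rcons us u) (aug_app z) -> z b != 0 ->
  (forall c, (rhoF c < rhoF b)%N -> z c = 0) ->
  exists e : idx C 1, [/\ diff C 0 e b != 0,
    forall c, c != b -> diff C 0 e c != 0 -> (rhoF b < rhoF c)%N
    & exists2 m, m \in msupp (z b : S) & (mlead (diff C 0 e b) <= m)%MM].
Proof.
move=> hz zc zb zlt; have [b0 [hb h1 hd]] := lc_unit hF.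
set m := mlead (z b : S); have hm : m \in msupp (z b : S) by apply: mlead_supp.
have [hus|hus] := boolP (has (fun v => (v <= m)%MM) us).
  have [|e [e1 e2 e3]] := rhoFP hz _ zb zlt; last by exists (inl e).
  rewrite /= /aug_ker (aug_appE _ hb h1) -(hb b) (multihomog_mono hz hm) -mul_mpolyC.
  exact/ideal_genM/mem_midealX.
have um : (u <= m)%MM.
  move: zc; rewrite (aug_appE _ hb h1) -(hb b) => /mem_mideal /(_ m hm).
  by rewrite has_rcons (negPf hus) orbF.
have [g0 [hg0 hg1 hg2]] := lc_unit hG.
have nz : (phi g0 b)@_u != 0.
  have := hlift g0; rewrite hg1 mul1r (aug_appE _ hb h1) -(hb b) app_fbasis => /mem_mideal.
  move/(_ u)=> h; suff -> : (phi g0 b)@_u = 1 by apply: oner_neq0.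
  apply/eqP; rewrite -subr_eq0; apply: contraNT hus => ne.
  have /hasP[v vus vu] : has (fun v => (v <= u)%MM) us.
    by apply: h; rewrite mcoeff_msupp mcoeffB mcoeffX eqxx.
  by apply/hasP; exists v => //; apply: lepm_trans um.
have nz' : phi g0 b != 0 by apply: contraNneq nz => ->; rewrite mcoeff0.
exists (inr g0); split=> //=; first by move=> c; rewrite (hb c) (hb b) eqxx.
exists m => //; suff -> : mlead (phi g0 b) = u by [].
apply: multideg_inj; have /graded_mapP/(_ g0 b _ (mlead_supp nz')) := hphi.1 0%N.
by rewrite (hb b) hd addr0 => ->; rewrite /= hg2 add0r.
Qed.

Lemma cone_lead p (z : fmod K n (idx C p)) a b :
  multihomog (deg C p) z a -> cycles (@aug_ker _ _ C (mideal K (rcons us u))) z ->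
  z b != 0 -> (forall c, (cone_rank c < cone_rank b)%N -> z c = 0) ->
  exists e : idx C p.+1, [/\ diff C p e b != 0,
    forall c, c != b -> diff C p e c != 0 -> (cone_rank b < cone_rank c)%N
    & exists2 m, m \in msupp (z b : S) & (mlead (diff C p e b) <= m)%MM].
Proof.
case: p z b => [|q] z b hz zc zb zlt; first exact: cone_lead0 hz zc zb zlt.
case: b zb zlt => [f|g] zb zlt.
  have r0 : rpart z = 0 by apply/ffunP => g; rewrite !ffunE zlt // cone_rank_lt.
  have zE c : lpart z c = z (inl c) by rewrite ffunE.
  have hl : multihomog (deg F q.+1) (lpart z) a by move=> c m; rewrite zE; apply: (hz (inl c)).
  have lc : cycles (@aug_ker _ _ F (mideal K us)) (lpart z).
    case: q z hz zc f zb zlt r0 {zE hl} => [|q] z hz zc f zb zlt r0 /=.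
      by move: zc; rewrite /= cone_app0 r0 app0 addr0.
    by have := cone_appl z; rewrite r0 app0 addr0 => <-; rewrite [app _ _]zc; apply/ffunP => c; rewrite !ffunE.
  have [||e [e1 e2 [m hm e3]]] := rhoFP (b:=f) hl lc.
  - by rewrite zE.
  - by move=> c h; rewrite zE zlt //= ltn_add2l.
  exists (inl e); split=> //; last by exists m => //; rewrite -zE.
  case=> c /=; last by rewrite eqxx.
  move=> ne /e2; rewrite ltn_add2l; apply; by apply: contraNneq ne => ->.
have zE c : rpart z c = z (inr c) by rewrite ffunE.
have hr : multihomog (deg G q) (rpart z) (a - multideg u).
  by move=> c m; rewrite zE => hm; rewrite -(hz (inr c) m hm) /= addrA addrK.
have rc : cycles (@aug_ker _ _ G (mideal K vs)) (rpart z).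
  case: q z hz zc g zb zlt {zE hr} => [|q] z hz zc g zb zlt.
    move: zc; rewrite /= cone_app0 => /(congr1 (@aug_app K n F)).
    rewrite aug_appD aug_app0 => /eqP; rewrite addr_eq0 => /eqP zc.
    apply/hL; rewrite /colon -[X in mideal _ _ X](subKr (aug_app (app (phi (p:=0)) (rpart z)))).
    rewrite -mulN1r; apply: ideal_genD; last by apply: ideal_genM; apply: lifts_aug.
    rewrite -[X in ideal_gen _ X]opprK -zc -mulN1r; apply: ideal_genM; exact: (lc_dd hF 0).
  have := cone_appr z; rewrite [app _ _]zc.
  have -> : rpart (0 : fmod K n (idx C q.+1)) = 0 by apply/ffunP => c; rewrite !ffunE.
  by move/eqP; rewrite eq_sym oppr_eq0 => /eqP.
have [||e [e1 e2 [m hm e3]]] := rhoGP (b:=g) hr rc.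
- by rewrite zE.
- by move=> c h; rewrite zE zlt.
exists (inr e); split=> /=; first by rewrite oppr_eq0.
  case=> c; first by move=> _ _; exact: cone_rank_lt.
  by move=> ne; rewrite oppr_eq0; apply: e2; apply: contraNneq ne => ->.
by exists m; rewrite -?zE // mleadN.
Qed.

End Lead.

(** If [F] and [G] satisfy the criterion for [us] and for the colon ideal, so does
    the cone for the sequence extended by [u]. *)
Lemma cone_lead_complex : lead_complex C (rcons us u).
Proof.
have [rhoF rhoFP] := lc_lead hF; have [rhoG rhoGP] := lc_lead hG; split.
- exact: lc_unit hF.
- exact: cone_graded.
- exact: cone_dd.
- exists (cone_rank rhoF rhoG); exact: cone_lead.
Qed.

End Cone.

Section Iterated.
Variables (K : fieldType) (n : nat).

Lemma same_ideal_eq (I J : {mpoly K[n]} -> Prop) : same_ideal I J -> I = J.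
Proof.
by move=> h; apply: functional_extensionality => f; apply: propositional_extensionality.
Qed.

Lemma principal_lead_complex (u : 'X_{1..n}) : lead_complex (principal K u) [:: u].
Proof.
split.
- by exists tt; split=> // -[].
- move=> p; apply/graded_mapP; case: p => [|[|p]] [] [] m //=.
  by rewrite msuppX inE addr0 => /eqP ->.
- case=> [|p] y /=; last first.
    by apply: app_app_eq0 => -[].
  rewrite /aug_ker /aug_app; elim/big_ind: _ => [||[] _]; [exact: ideal_gen0|exact: ideal_genD|].
  rewrite mulr1 ffunE; elim/big_ind: _ => [||[] _]; [exact: ideal_gen0|exact: ideal_genD|].
  by apply/ideal_genM/mem_midealX; rewrite /= lepm_refl.
- exists (fun _ _ => 0%N); case=> [|[|p]] z a []; rewrite ?ltn0 //= => hz zc zb _.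
    exists tt; set m := mlead (z tt : {mpoly K[n]}).
    have hm : m \in msupp (z tt : {mpoly K[n]}) by apply: mlead_supp.
    split; [|by case|exists m => //].
      by have := @signX_neq0 K n 0 u; rewrite mul1r.
    rewrite mleadXm; move: zc; rewrite /aug_ker (@aug_appE _ _ (principal K u) tt) //; last by case.
    by move=> /mem_mideal /(_ m hm) /=; rewrite orbF.
  move: zc => /ffunP/(_ tt); rewrite ffunE (bigD1 tt) //= big1; last by case.
  rewrite addr0 ffunE => /eqP; rewrite mulf_eq0 (negPf zb) /=.
  by have := @signX_neq0 K n 0 u; rewrite mul1r => /negPf ->.
Qed.

Lemma iterated_cone_lead_complex (us : seq 'X_{1..n}) (F : acomplex K n) :
  iterated_cone koszul_choice us F -> lead_complex F us.
Proof.
elim=> [u|{}us u {}F G phi _ hF _ [s [us_s hs hG]] hphi hlift]; first exact: principal_lead_complex.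
apply: cone_lead_complex hF _ hs hphi hlift.
rewrite hG koszul_taylor; first exact: taylor_lead_complex.
exact: vars_coprime.
Qed.

End Iterated.

(** * Canonical decompositions in stable ideals *)

Section MaxIndex.
Variable n : nat.
Implicit Types (w v : 'X_{1..n}) (k : 'I_n).

Lemma leq_max_index w k : (0 < w k)%N -> (k < max_index w)%N.
Proof. by move=> h; apply: (leq_bigmax_cond (F := fun i : 'I_n => i.+1) k). Qed.

Lemma max_indexP w k : (0 < w k)%N ->
  exists2 l : 'I_n, (0 < w l)%N & l.+1 = max_index w.
Proof.
move=> hk; have [|l hl e] := @eq_bigmax_cond 'I_n (fun i => 0 < w i)%N (fun i => i.+1).
  by apply/card_gt0P; exists k.
by exists l.
Qed.

Lemma max_index_gt w (i : nat) : (i < max_index w)%N -> exists2 k, (0 < w k)%N & (i <= k)%N.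
Proof.
move=> h; case: (pickP (fun k => 0 < w k)%N) => [k /max_indexP[l hl e]|none].
  by exists l => //; rewrite -ltnS e.
by rewrite /max_index big_pred0 in h.
Qed.

Lemma mnm_neq0 w : w != 0%MM -> exists k, (0 < w k)%N.
Proof.
move=> nz; case: (pickP (fun k => 0 < w k)%N) => [k hk|none]; first by exists k.
case/eqP: nz; apply/mnmP => k; rewrite mnm0E; have := none k; by case: (w k).
Qed.

Lemma lem_mdeg w v : (v <= w)%MM -> (mdeg v <= mdeg w)%N.
Proof. by move=> vw; rewrite -(submK vw) mdegD leq_addl. Qed.

Lemma lem_mdeg_eq w v : (v <= w)%MM -> (mdeg w <= mdeg v)%N -> v = w.
Proof.
move=> vw; rewrite -{1}(submK vw) mdegD => h.
have /eqP : mdeg (w - v)%MM == 0%N by lia.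
move/eqP; rewrite mdeg_eq0 => /eqP e; by rewrite -[RHS](submK vw) e add0m.
Qed.

End MaxIndex.

Lemma commuting_entries (R : comPzRingType) (x x' e e1 e2 e3 y y' z z' : R) :
  y' * z' = y * z ->
  x * (e * x' - e1 * y') - y * (e2 * x' - e3 * z) =
  x' * (e * x - e2 * y) - y' * (e1 * x - e3 * z').
Proof. by move=> h; ring: h. Qed.

Section Stable.
Variables (K : fieldType) (n : nat) (us : seq 'X_{1..n}).
Local Notation S := {mpoly K[n]}.
Local Notation u a := (nth 0%MM us a).
Local Notation ix := 'I_(size us).
Implicit Types (w v : 'X_{1..n}) (a b c : ix) (i j k l : 'I_n).

(* The ideal generated by [us] is stable, and [us] lists its minimal generators
   in the order of the Eliahou-Kervaire resolution. *)
Hypothesis us_stable : stable (mideal K us).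
Hypothesis us_min : forall x y : nat,
  (x < size us)%N -> (y < size us)%N -> (u x <= u y)%MM -> x = y.
Hypothesis us_ord : ek_ordered us.

Lemma mem_gens w : has (fun v => (v <= w)%MM) us <-> exists a : ix, (u a <= w)%MM.
Proof.
split=> [/(has_nthP 0%MM)[i hi le]|[a le]]; first by exists (Ordinal hi).
by apply/hasP; exists (u a) => //; apply: mem_nth.
Qed.

Lemma stable_gens w j k : (exists a : ix, (u a <= w)%MM) -> k.+1 = max_index w -> (j < k)%N ->
  exists a : ix, (u a <= U_(j) + (w - U_(k)))%MM.
Proof.
move=> /mem_gens h e jk; apply/mem_gens/(mem_midealX K); apply: us_stable e jk.
exact/mem_midealX.
Qed.

Lemma gen_min a b : (u a <= u b)%MM -> a = b.
Proof. by move=> h; apply: val_inj; exact: us_min (ltn_ord a) (ltn_ord b) h. Qed.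

Lemma canonical_genP w a :
  reflect ((u a <= w)%MM /\ forall k l, (0 < u a k)%N -> (u a l < w l)%N -> (k <= l)%N)
          (canonical_gen w a).
Proof.
apply: (iffP andP) => -[h h']; split=> //.
  move=> k l hk hl; move/forallP: h' => /(_ k) /forallP /(_ l).
  by rewrite hk mnmBE subn_gt0 hl.
apply/forallP => k; apply/forallP => l; apply/implyP => hk; apply/implyP.
by rewrite mnmBE subn_gt0; apply: h'.
Qed.

(** Of two canonical generators of [w], one divides the other: both are initial
    segments of [w] written with its variables in increasing order. *)
Lemma canonical_gen_uniq w a b : canonical_gen w a -> canonical_gen w b -> a = b.
Proof.
move=> /canonical_genP[/mnm_lepP aw ha] /canonical_genP[/mnm_lepP bw hb].
case: (pickP (fun k => u b k < u a k)%N) => [k bk|none]; last first.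
  by apply: gen_min; apply/mnm_lepP => k; have := none k; lia.
apply/esym/gen_min/mnm_lepP => l; have [lk|kl|/val_inj ->] := ltngtP l k; last exact: ltnW.
  have := ha k l; have := bw l; have := aw l; lia.
have := hb l k; have := aw k; lia.
Qed.

(** If [u_b] divides [w] and involves the full power of the last variable of
    [w], trading one copy of it for an earlier variable yields a multiple of
    an earlier generator. *)
Lemma gen_divides_pred w b k : (u b <= w)%MM -> u b != w -> k.+1 = max_index w ->
  (0 < w k)%N -> exists2 c : ix, (u c <= w - U_(k))%MM & (c <= b)%N.
Proof.
move=> bw ne ek wk; have bw' := mnm_lepP bw.
have [hk|hk] := ltnP (u b k) (w k).
  exists b => //; apply/mnm_lepP => l; rewrite mnmBE mnm1E.
  by case: (k =P l) => [<-|_]; have := bw' l; lia.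
have ub : u b k = w k by apply/eqP; rewrite eqn_leq hk bw'.
have [l hl] : exists l, (u b l < w l)%N.
  case: (pickP (fun l => u b l < w l)%N) => [l|none]; first by exists l.
  case/eqP: ne; apply/mnmP => l; apply/eqP; rewrite eqn_leq bw' /=.
  by have := none l; lia.
have lk : (l < k)%N.
  have lnk : l != k by apply: contraTneq hl => ->; rewrite ub ltnn.
  have := @leq_max_index _ w l (leq_ltn_trans (leq0n _) hl); rewrite -ek ltnS leq_eqVlt.
  by case/orP => // /eqP /val_inj e; rewrite e eqxx in lnk.
have eub : k.+1 = max_index (u b).
  have [|x hx ex] := @max_indexP _ (u b) k; first by rewrite ub.
  apply/eqP; rewrite eqn_leq leq_max_index ?ub //= -ex ek leq_max_index //.
  exact: leq_trans (bw' x).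
have vE x : (U_(l) + (u b - U_(k)))%MM x = ((l == x) + (u b x - (k == x)))%N.
  by rewrite mnmDE mnmBE !mnm1E.
have [|c cv] := @stable_gens (u b) l k _ eub lk; first by exists b; apply: lepm_refl.
have cv' := mnm_lepP cv.
have mv : mdeg (U_(l) + (u b - U_(k)))%MM = mdeg (u b).
  have kb : (U_(k) <= u b)%MM by rewrite lep1mP ub -lt0n.
  by rewrite mdegD mdeg1 -[in RHS](submK kb) mdegD mdeg1 addnC.
exists c.
  apply/mnm_lepP => x; apply: leq_trans (cv' x) _; rewrite vE mnmBE mnm1E.
  have [e|ne1] := eqVneq k x; last first.
    by case: (l =P x) => [<-|_]; have := bw' x; lia.
  subst x; have -> : (l == k) = false by apply/negbTE; rewrite neq_ltn lk.
  by rewrite ub.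
rewrite leqNgt; apply/negP => bc.
have [|lt|[eqd [x [xlt xk]]]] := us_ord (i := b) (j := c); first by rewrite bc ltn_ord.
  by have := lem_mdeg cv; rewrite mv leqNgt lt.
have vc : u c = (U_(l) + (u b - U_(k)))%MM by apply: lem_mdeg_eq => //; rewrite mv eqd.
have [e|ne1] := eqVneq k x.
  by have := xlt l; rewrite -e lk vc vE eqxx => /(_ isT); have := lk; case: (k =P l) => [->|_]; lia.
by move: xk; rewrite vc vE (negPf ne1) subn0; lia.
Qed.

(** Every monomial of the ideal has a canonical decomposition, and its canonical
    generator is the first generator dividing it. *)
Lemma canonical_gen_exists w : (exists a : ix, (u a <= w)%MM) ->
  exists2 a : ix, canonical_gen w a & forall b, (u b <= w)%MM -> (a <= b)%N.
Proof.
elim/(@ltn_ind): {w}(mdeg w) {-2}w (erefl (mdeg w)) => d IH w dw [b bw].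
case: (pickP (fun a => u a == w)) => [a /eqP aw|none].
  exists a => [|c]; last by rewrite -aw => /gen_min ->.
  by apply/canonical_genP; rewrite aw; split=> [|k l _]; [exact: lepm_refl|rewrite ltnn].
have ne c : u c != w by rewrite none.
have [k0 hk0] : exists k, (0 < w k)%N.
  apply: mnm_neq0; apply: contraFneq (none b) => w0.
  apply/eqP/mnmP => x; move/mnm_lepP: bw => /(_ x); rewrite w0 mnm0E; lia.
have [k wk ek] := max_indexP hk0.
have kw : (U_(k) <= w)%MM by rewrite lep1mP -lt0n.
have [c0 c0w _] := gen_divides_pred bw (ne b) ek wk.
have dlt : (mdeg (w - U_(k))%MM < d)%N by rewrite -dw -[in X in (_ < X)%N](submK kw) mdegD mdeg1 addn1.
have [|a /canonical_genP[aw ha] amin] := IH _ dlt (w - U_(k))%MM erefl; first by exists c0.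
exists a.
  apply/canonical_genP; split; first exact: lepm_trans aw (lem_subr _ _).
  move=> x l hx hl; have [e|nl] := eqVneq k l.
    rewrite -e -ltnS ek; apply: leq_max_index.
    by have /mnm_lepP/(_ x) := aw; rewrite mnmBE; lia.
  by apply: ha => //; rewrite mnmBE mnm1E (negPf nl) subn0.
move=> c cw; have [c' c'w cc] := gen_divides_pred cw (ne c) ek wk.
exact: leq_trans (amin c' c'w) cc.
Qed.

Lemma canonical_gen_first w a b : canonical_gen w a -> (u b <= w)%MM -> (a <= b)%N.
Proof.
move=> ha bw; have [|c hc cmin] := canonical_gen_exists (w := w); first by exists b.
by rewrite (canonical_gen_uniq ha hc) cmin.
Qed.

(** Multiplying a generator by [v] and passing to the canonical generator does
    not bring in larger variables. *)
Lemma canonical_gen_max v a b k : canonical_gen (v + u a)%MM b -> (0 < u b k)%N ->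
  exists2 l : 'I_n, (0 < u a l)%N & (k <= l)%N.
Proof.
move=> /canonical_genP[/mnm_lepP bw hb] bk.
case: (pickP (fun l => (0 < u a l) && (k <= l))%N) => [l /andP[]|none]; first by exists l.
have ab : a = b.
  apply/gen_min/mnm_lepP => l; have := hb k l bk; have := none l; have := bw l.
  rewrite mnmDE; case: (u a l) => [|x]; rewrite ?leq0n //=; lia.
by exists k; rewrite // ab.
Qed.

Lemma canonical_gen_max_index v a b : canonical_gen (v + u a)%MM b ->
  (max_index (u b) <= max_index (u a))%N.
Proof.
move=> h; rewrite leqNgt; apply/negP => /max_index_gt[k bk hk].
by have [l al kl] := canonical_gen_max h bk; have := leq_max_index al; lia.
Qed.

(** The canonical generator of [v w] is that of [v u_a], where [u_a] is the
    canonical generator of [w]. *)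
Lemma canonical_gen_comp v w a b :
  canonical_gen w a -> canonical_gen (v + u a)%MM b -> canonical_gen (v + w)%MM b.
Proof.
move=> /canonical_genP[/mnm_lepP aw ha] hb'; have /canonical_genP[/mnm_lepP bw hb] := hb'.
apply/canonical_genP; split=> [|k l bk].
  by apply/mnm_lepP => l; have := bw l; have := aw l; rewrite !mnmDE; lia.
rewrite mnmDE => bl; have [h|h] := ltnP (u b l) (v l + u a l).
  by apply: hb; rewrite // mnmDE.
have [x ax kx] := canonical_gen_max hb' bk.
by apply: leq_trans kx (ha _ _ ax _); lia.
Qed.

(** * The Eliahou-Kervaire complex *)

(** The index of the canonical generator of x_i u_a. *)
Definition next_gen i a : ix :=
  odflt a [pick b | canonical_gen (U_(i) + u a)%MM b].

Lemma canonical_gen_next i a b : canonical_gen (U_(i) + u a)%MM b = (b == next_gen i a).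
Proof.
rewrite /next_gen; case: pickP => [c hc|none] /=; last first.
  have [|c] := canonical_gen_exists (w := (U_(i) + u a)%MM); last by rewrite none.
  by exists a; apply: lem_addl.
apply/idP/eqP => [hb|-> //]; exact: canonical_gen_uniq hb hc.
Qed.

Lemma next_genP i a : canonical_gen (U_(i) + u a)%MM (next_gen i a).
Proof. by rewrite canonical_gen_next. Qed.

Lemma next_gen_sub i a : (u (next_gen i a) <= U_(i) + u a)%MM.
Proof. by have /canonical_genP[] := next_genP i a. Qed.

Lemma next_gen_leq i a : (next_gen i a <= a)%N.
Proof. by apply: canonical_gen_first (next_genP i a) (lem_addl _ _). Qed.

Lemma next_genC i j a : next_gen j (next_gen i a) = next_gen i (next_gen j a).
Proof.
apply: (@canonical_gen_uniq (U_(j) + (U_(i) + u a))%MM).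
  exact: canonical_gen_comp (next_genP i a) (next_genP j _).
rewrite addmA [(U_(j) + U_(i))%MM]addmC -addmA; exact: canonical_gen_comp (next_genP j a) (next_genP i _).
Qed.

Lemma next_gen_id i a : (max_index (u a) <= i.+1)%N -> next_gen i a = a.
Proof.
move=> h; apply/esym/eqP; rewrite -canonical_gen_next; apply/canonical_genP.
split=> [|k l ak]; first exact: lem_addl.
rewrite mnmDE mnm1E; case: (i =P l) => [<- _|_]; last by rewrite ltnn.
by rewrite -ltnS (leq_trans (leq_max_index ak)).
Qed.

Lemma next_gen_neq i a : (i.+1 < max_index (u a))%N -> (a == next_gen i a) = false.
Proof.
move=> h; rewrite -canonical_gen_next; apply/negP => /canonical_genP[_ ha].
have [k ak ik] := max_index_gt h.
by have := ha k i ak; rewrite mnmDE mnm1E eqxx; lia.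
Qed.

(** The operator accompanying the removal of [x_i] from a symbol: it sends
    [e_a] to [x_i e_a - (x_i u_a / u_b) e_b], where [u_b] is the canonical
    generator of [x_i u_a]. *)
Definition ek_coef i a b : S :=
  (a == b)%:R * 'X_i - (canonical_gen (U_(i) + u a)%MM b)%:R * 'X_[(U_(i) + u a - u b)%MM].

Lemma sum_ek_coef i a (g : ix -> S) :
  \sum_c ek_coef i a c * g c =
  'X_i * g a - 'X_[(U_(i) + u a - u (next_gen i a))%MM] * g (next_gen i a).
Proof.
rewrite /ek_coef; under eq_bigr do rewrite mulrBl canonical_gen_next.
rewrite sumrB; congr (_ - _).
  rewrite (bigD1 a) //= eqxx mul1r big1 ?addr0 // => c ne.
  by rewrite eq_sym (negPf ne) !mul0r.
rewrite (bigD1 (next_gen i a)) //= eqxx mul1r big1 ?addr0 // => c ne.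
by rewrite (negPf ne) !mul0r.
Qed.

Lemma ek_coefE i a b : ek_coef i a b =
  (a == b)%:R * 'X_i - (next_gen i a == b)%:R * 'X_[(U_(i) + u a - u (next_gen i a))%MM].
Proof.
rewrite /ek_coef canonical_gen_next [b == next_gen _ _]eq_sym.
by case: (next_gen i a =P b) => [->|]; rewrite ?mul0r.
Qed.

(** The operators removing [x_i] and [x_j] commute, because applying both ends
    at the canonical generator of [x_i x_j u_a] in either order. *)
Lemma ek_coefC i j a b :
  \sum_c ek_coef i a c * ek_coef j c b = \sum_c ek_coef j a c * ek_coef i c b.
Proof.
have mono x y : 'X_[(U_(x) + u a - u (next_gen x a))%MM] *
    'X_[(U_(y) + u (next_gen x a) - u (next_gen y (next_gen x a)))%MM] =
    'X_[(U_(x) + U_(y) + u a - u (next_gen y (next_gen x a)))%MM] :> S.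
  rewrite -mpolyXD; congr 'X_[_]; apply/mnmP => k; rewrite !(mnmDE, mnmBE).
  have /mnm_lepP/(_ k) := next_gen_sub x a; have /mnm_lepP/(_ k) := next_gen_sub y (next_gen x a).
  by rewrite !mnmDE; lia.
have key := mono j i; rewrite (next_genC j i) [(U_(j) + U_(i))%MM]addmC -mono in key.
rewrite !sum_ek_coef !ek_coefE (next_genC j i).
exact: commuting_entries.
Qed.

(** The differential on all symbols [e(sigma; u_a)], admissible or not. *)
Definition ek_entry (x y : {set 'I_n} * ix) : S :=
  \sum_(i in x.1 | y.1 == x.1 :\ i) (-1) ^+ (pos x.1 i).+1 * ek_coef i x.2 y.2.

Local Notation EK := (eliahou_kervaire K us).

Lemma ek_diffE q (x : ek_idx us q.+2) (y : ek_idx us q.+1) :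
  diff EK q.+1 x y = ek_entry (val x) (val y).
Proof. by case: x y => [[s a] hx] [[t b] hy]. Qed.

Lemma ek_entry_face (s : {set 'I_n}) i a b : i \in s ->
  ek_entry (s, a) (s :\ i, b) = (-1) ^+ (pos s i).+1 * ek_coef i a b.
Proof. by move=> si; rewrite /ek_entry /= sum_face. Qed.

Lemma ek_entry_neq0 (x y : {set 'I_n} * ix) : ek_entry x y != 0 ->
  exists i : 'I_n, [/\ i \in x.1, y.1 = x.1 :\ i & ek_coef i x.2 y.2 != 0].
Proof.
move=> nz; have [i ix_ e] := sum_face_neq0 nz; exists i; split=> //.
case: x y nz ix_ e => [s a] [t b] /= nz si e; move: nz; rewrite e ek_entry_face //.
by apply: contraNneq => ->; rewrite mulr0.
Qed.

Lemma ek_coef_neq0 i a b : ek_coef i a b != 0 -> a = b \/ b = next_gen i a.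
Proof.
rewrite /ek_coef canonical_gen_next; have [->|_] := eqVneq a b; first by left.
have [->|_] := eqVneq b (next_gen i a); first by right.
by rewrite !mul0r subrr eqxx.
Qed.

Lemma ek_coef_leq i a b : ek_coef i a b != 0 -> (b <= a)%N.
Proof. by move=> /ek_coef_neq0[->|->] //; apply: next_gen_leq. Qed.

Lemma ek_coef_diag i a : (i.+1 < max_index (u a))%N -> ek_coef i a a = 'X_i.
Proof.
by move=> h; rewrite /ek_coef canonical_gen_next next_gen_neq // eqxx mul1r mul0r subr0.
Qed.

(** Sums over all symbols against a row of the differential, split into the
    removed variable and the new generator. *)
Lemma sum_ek_entry (x : {set 'I_n} * ix) (g : {set 'I_n} * ix -> S) :
  \sum_z ek_entry x z * g z =
  \sum_(i in x.1) (-1) ^+ (pos x.1 i).+1 * \sum_c ek_coef i x.2 c * g (x.1 :\ i, c).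
Proof.
rewrite (eq_bigr (fun z => ek_entry x (z.1, z.2) * g (z.1, z.2))); last by case.
rewrite -(pair_bigA _ (fun t c => ek_entry x (t, c) * g (t, c))) /= exchange_big /=.
under [RHS]eq_bigr do rewrite mulr_sumr.
rewrite [RHS]exchange_big /=; apply: eq_bigr => c _.
under eq_bigr do rewrite mulr_suml.
rewrite (exchange_big_dep (mem x.1)) /=; last by move=> ? ? _ /andP[].
apply: eq_bigr => i xi.
by rewrite (big_pred1 (x.1 :\ i)) ?mulrA // => t; rewrite xi.
Qed.

Lemma ek_entry_dd x y : \sum_z ek_entry x z * ek_entry z y = 0.
Proof.
rewrite sum_ek_entry -[RHS](@sum_sign_swap _ S x.1
  (fun i j => (y.1 == x.1 :\ i :\ j)%:R * \sum_c ek_coef i x.2 c * ek_coef j c y.2)); last first.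
  move=> i j; have -> : x.1 :\ i :\ j = x.1 :\ j :\ i by apply/setP => k; rewrite !inE andbCA.
  by rewrite ek_coefC.
apply: eq_bigr => i _; rewrite exprS mulN1r mulNr -mulrN; congr (_ * _).
rewrite -sumrN [RHS](eq_bigr (fun j => \sum_c
  (y.1 == x.1 :\ i :\ j)%:R * ((-1) ^+ pos (x.1 :\ i) j * (ek_coef i x.2 c * ek_coef j c y.2)))).
  rewrite [RHS]exchange_big /=; apply: eq_bigr => c _.
  rewrite /ek_entry /= big_mkcondr mulr_sumr -sumrN; apply: eq_bigr => j _.
  case: eqP => _; rewrite ?mul0r ?mulr0 ?oppr0 // exprS mulN1r mulNr mulrN opprK mul1r.
  by rewrite mulrCA.
by move=> j _; rewrite mulrCA !mulr_sumr.
Qed.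

(** The inadmissible symbols span a subcomplex: the two terms removing a variable
    of index at least [m(u_a)] cancel. *)
Lemma ek_entry_admissible q x y z : ek_symbol q.+1 x -> ek_symbol q.-1 y ->
  ek_entry x z != 0 -> ek_entry z y != 0 -> ek_symbol q z.
Proof.
move=> /andP[/eqP cx _] /andP[_ /forallP hy] /ek_entry_neq0[i [xi zi _]].
move=> /ek_entry_neq0[j [zj yj nz]]; rewrite /ek_symbol zi; apply/andP; split.
  by apply: cards_setD1 => //; rewrite cx.
rewrite -zi; apply/forallP => k; apply/implyP => zk; rewrite ltnNge; apply/negP => hk.
have [e|ne] := eqVneq k j.
  move: nz; rewrite -e ek_coefE next_gen_id // addmK subrr.
  by rewrite eqxx.
have yk : k \in y.1 by rewrite yj !inE ne.
have := hy k; rewrite yk /= ltnNge; apply/negP; rewrite negbK.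
have [<- //|e] := ek_coef_neq0 nz.
apply: leq_trans hk; rewrite e; apply: canonical_gen_max_index (next_genP j _).
Qed.

Lemma ek_dd q (x : ek_idx us q.+3) (y : ek_idx us q.+1) :
  \sum_z diff EK q.+2 x z * diff EK q.+1 z y = 0.
Proof.
under eq_bigr do rewrite !ek_diffE.
rewrite (sum_sig (@ek_symbol n us q.+1) (fun z => ek_entry (val x) z * ek_entry z (val y))).
rewrite -[RHS](ek_entry_dd (val x) (val y)) [RHS](bigID (ek_symbol q.+1)) /=.
rewrite [X in _ = _ + X]big1 ?addr0 // => z hz; apply/eqP; apply: contraNT hz.
rewrite mulf_eq0 negb_or => /andP[h1 h2].
exact: ek_entry_admissible (valP x) (valP y) h1 h2.
Qed.

Lemma ek_dd0 (x : ek_idx us 2) (y : ek_idx us 0) :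
  \sum_z diff EK 1 x z * diff EK 0 z y = 0.
Proof.
under eq_bigr do rewrite ek_diffE /=.
rewrite (sum_sig (@ek_symbol n us 0) (fun z => ek_entry (val x) z * 'X_[u z.2])).
have cx : #|(val x).1| == 1%N by case/andP: (valP x).
transitivity (\sum_z ek_entry (val x) z * 'X_[u z.2]).
  rewrite [RHS](bigID (ek_symbol 0)) /= [X in _ = _ + X]big1 ?addr0 // => z hz.
  apply/eqP; apply: contraNT hz; rewrite mulf_eq0 negb_or => /andP[/ek_entry_neq0[i [xi zi _]] _].
  have c0 : #|z.1| == 0%N by rewrite zi; apply: cards_setD1.
  apply/andP; split=> //; apply/forallP => k; apply/implyP.
  by move: c0; rewrite cards_eq0 => /eqP ->; rewrite inE.
rewrite sum_ek_entry big1 // => i _; rewrite sum_ek_coef /= -!mpolyXD.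
by rewrite submK ?next_gen_sub // subrr mulr0.
Qed.

Lemma ek_graded p : graded_map (deg EK p.+1) (deg EK p) (diff EK p).
Proof.
apply/graded_mapP; case: p => [|q] x y m.
  rewrite msuppX inE => /eqP -> /=; rewrite addr0.
  have /andP[+ _] := valP x; rewrite cards_eq0 => /eqP ->.
  by rewrite big_set0 addr0.
rewrite ek_diffE; case: x y => [[s a] hx] [[t b] hy] /= hm.
have [|i [/= si ti _]] := @ek_entry_neq0 (s, a) (t, b).
  by apply: contraTneq hm => ->; rewrite msupp0.
rewrite (big_setD1 i si) /= -ti; move: hm.
rewrite {hy}ti ek_entry_face // -signr_odd mulr_sign.
have -> : (m \in msupp (if odd (pos s i).+1 then - ek_coef i a b else ek_coef i a b)) =
   (m \in msupp (ek_coef i a b)) by case: ifP => _; rewrite ?(perm_mem (msuppN _)).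
rewrite /ek_coef => /msuppB_le; rewrite mem_cat => /orP[].
  have [<-|_] := eqVneq a b; rewrite ?mul0r ?msupp0 // mul1r msuppX inE => /eqP ->.
  by rewrite addrCA.
have [hb|_] := boolP (canonical_gen _ _); rewrite ?mul0r ?msupp0 // mul1r msuppX inE => /eqP ->.
have /canonical_genP[bs _] := hb.
by rewrite addrA -multidegD submK // multidegD addrCA addrA.
Qed.

(** Symbols on later generators come first; on the same generator, those with the
    smaller set weight.  The factor [n * n + 1] exceeds every set weight. *)
Definition ek_rank (p : nat) : idx EK p -> nat :=
  match p return idx EK p -> nat with
  | 0 => fun _ => 0%N
  | q.+1 => fun x => ((size us - (val x).2) * (n * n).+1 + set_weight (val x).1)%N
  end.

Lemma set_weight_bound (s : {set 'I_n}) : (set_weight s <= n * n)%N.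
Proof.
apply: leq_trans (_ : \sum_(i in s) n <= _)%N; first by apply: leq_sum => i _; apply: leq_subr.
by rewrite sum_nat_const leq_mul2r -[X in (_ <= X)%N]card_ord max_card orbT.
Qed.

Lemma ek_rank_gen q (x y : ek_idx us q.+1) : ((val y).2 < (val x).2)%N ->
  (ek_rank x < ek_rank y)%N.
Proof.
move=> h /=; have := set_weight_bound (val x).1; have := ltn_ord (val x).2.
set A := (size us - (val x).2)%N; set B := (size us - (val y).2)%N => h1 h2.
have AB : (A < B)%N by rewrite /A /B; lia.
apply: (@leq_trans (A.+1 * (n * n).+1)); first by rewrite mulSn addnC ltn_add2r ltnS.
by rewrite (leq_trans _ (leq_addr _ _)) // leq_mul2r AB orbT.
Qed.

Lemma ek_rank_set q (x y : ek_idx us q.+1) : (val x).2 = (val y).2 ->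
  (set_weight (val x).1 < set_weight (val y).1)%N -> (ek_rank x < ek_rank y)%N.
Proof. by move=> /= -> h; rewrite ltn_add2l. Qed.

(** If [i < m(u_a)] and [i] is smaller than all elements of [sigma], then the
    boundary of [e(i, sigma; u_a)] leads at [e(sigma; u_a)], with coefficient
    [x_i] up to sign. *)
Lemma ek_boundary_lead q (x : ek_idx us q.+1) i :
  (i.+1 < max_index (u (val x).2))%N -> (forall t, t \in (val x).1 -> (i < t)%N) ->
  exists e : ek_idx us q.+2, [/\ diff EK q.+1 e x != 0,
    forall y, y != x -> diff EK q.+1 e y != 0 -> (ek_rank x < ek_rank y)%N
    & mlead (diff EK q.+1 e x) = U_(i)%MM].
Proof.
move=> ia lt_s; have hx := valP x; case xE: (val x) => [s a].
rewrite xE in hx ia lt_s; simpl in ia, lt_s; have /andP[cs /forallP hs] := hx.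
have si : i \notin s by apply/negP => /lt_s; rewrite ltnn.
have he : ek_symbol q.+1 (i |: s, a).
  rewrite /ek_symbol /= cardsU1 si add1n eqSS cs; apply/forallP => j; apply/implyP.
  by rewrite !inE => /orP[/eqP -> //|sj]; have := hs j; rewrite sj.
have [e eE] : exists e : ek_idx us q.+2, val e = (i |: s, a).
  by exists (exist _ (i |: s, a) he).
have dE : diff EK q.+1 e x = (-1) ^+ (pos (i |: s) i).+1 * 'X_i.
  by rewrite ek_diffE eE xE /ek_entry /= sum_faceU1 // ek_coef_diag.
exists e; rewrite dE; split; [exact: signX_neq0| |exact: mlead_signX].
move=> y ne; rewrite ek_diffE eE => entry_neq0.
have [j [sj yj nz]] : exists j : 'I_n, [/\ j \in i |: s, (val y).1 = (i |: s) :\ j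
    & ek_coef j a (val y).2 != 0] := ek_entry_neq0 entry_neq0.
have := ek_coef_leq nz; rewrite leq_eqVlt => /orP[/eqP/val_inj ey|lt]; last first.
  by apply: ek_rank_gen; rewrite xE.
apply: ek_rank_set; rewrite xE //.
have ji : j != i.
  apply: contraNneq ne => ji; apply/eqP/val_inj; rewrite xE; move: yj ey; rewrite ji setU1K //.
  by case: (val y) => ? ? /= -> ->.
have js : j \in s by move: sj; rewrite !inE (negPf ji).
have -> : (val y).1 = i |: s :\ j.
  by rewrite yj; apply/setP => k; rewrite !inE; case: (k =P i) => [->|]; rewrite //= eq_sym ji.
by apply: set_weight_gt => //; apply: lt_s.
Qed.

(** The basis element exhibited adds to [x] a variable of the leading coefficient
    that is smaller than those of [x].  If there were none, then for nonempty
    [sigma] the entry of the boundary at [sigma] minus its least element would not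
    vanish; for empty [sigma] the leading generator would be the canonical one for
    the degree of the cycle, while another term of the cycle involves an earlier
    generator. *)
Lemma ek_lead p (z : fmod K n (idx EK p)) d (x : idx EK p) :
  multihomog (deg EK p) z d -> cycles (@aug_ker _ _ EK (mideal K us)) z -> z x != 0 ->
  (forall y, (ek_rank y < ek_rank x)%N -> z y = 0) ->
  exists e : idx EK p.+1, [/\ diff EK p e x != 0,
    forall y, y != x -> diff EK p e y != 0 -> (ek_rank x < ek_rank y)%N
    & exists2 m, m \in msupp (z x : S) & (mlead (diff EK p e x) <= m)%MM].
Proof.
case: p z x => [|q] z x hz zc zx zlt; set m := mlead (z x : S);
  have hm : m \in msupp (z x : S) by apply: mlead_supp.
  have xE y : y = x by case: y; case: (x).
  move: zc; rewrite /= /aug_ker (@aug_appE _ _ EK x) // => /mem_mideal /(_ m hm) /mem_gens[a am].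
  have he : ek_symbol 0 (set0 : {set 'I_n}, a).
    by rewrite /ek_symbol /= cards0 eqxx; apply/forallP => j; rewrite inE.
  exists (exist _ (set0, a) he); split=> /=.
  - by have := @signX_neq0 K n 0 (u a); rewrite mul1r.
  - by [].
  - by exists m; rewrite ?mleadXm.
case: (pickP (fun i : 'I_n => [&& (i.+1 < max_index (u (val x).2))%N, (0 < m i)%N
    & [forall t in (val x).1, (i < t)%N]])) => [i /and3P[ia im /forallP it]|none].
  have [|e [e1 e2 e3]] := @ek_boundary_lead q x i ia.
    by move=> t xt; have := it t; rewrite xt.
  by exists e; split=> //; exists m; rewrite // e3 lep1mP -lt0n.
have none' i : (i.+1 < max_index (u (val x).2))%N -> (0 < m i)%N ->
    exists2 t : 'I_n, t \in (val x).1 & (t <= i)%N.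
  move=> h h'; have := none i; rewrite h h' /= => /negbT; rewrite negb_forall => /existsP[t].
  by rewrite negb_imply -leqNgt => /andP[]; exists t.
exfalso; case: q z x hz zc zx zlt m hm none none' => [|q] z x hz zc zx zlt m hm none none'.
  have set0E (y : ek_idx us 1) : (val y).1 = set0.
    by apply/eqP; rewrite -cards_eq0; case/andP: (valP y).
  have zc' : app (diff EK 0) z tt = 0 by rewrite zc ffunE.
  (* Here sigma is empty, and x carries the canonical generator of the degree. *)
  have canon : canonical_gen (m + u (val x).2)%MM (val x).2.
    apply/canonical_genP; split=> [|k l ak]; first exact: lem_addl.
    rewrite mnmDE => h; rewrite leqNgt; apply/negP => lk.
    have [||t] := none' l; [|lia|by rewrite set0E inE].
    exact: leq_ltn_trans lk (leq_max_index ak).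
  move: zc'; rewrite (@app_single _ _ _ _ _ _ x) /=.
    move/eqP; rewrite mulf_eq0 (negPf zx) /=.
    by have := @signX_neq0 K n 0 (u (val x).2); rewrite mul1r => /negPf ->.
  move=> y ne zy; exfalso; case/eqP: (zy); apply: zlt; apply: ek_rank_gen.
  have hy := mlead_supp zy; set m' := mlead _ in hy.
  have e : (m' + u (val y).2 = m + u (val x).2)%MM.
    have := hz _ _ hy; rewrite -(hz _ _ hm) /= !set0E !big_set0 !addr0.
    by rewrite -!multidegD => /multideg_inj.
  have := canonical_gen_first canon (b := (val y).2); rewrite -e lem_addl => /(_ isT).
  rewrite leq_eqVlt => /orP[/eqP/val_inj e2|//].
  case/eqP: ne; apply: val_inj; move: e2 (set0E x) (set0E y).
  by case: (val x) (val y) => [? ?] [? ?] /= -> -> ->.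
have /andP[cx /forallP ax] := valP x.
have [t0 t0x] : exists t, t \in (val x).1 by apply/card_gt0P; rewrite (eqP cx).
case: (arg_minnP (fun i : 'I_n => i : nat) t0x) => t /= tx tmin.
change (is_true (t \in (val x).1)) in tx.
have hG : ek_symbol q ((val x).1 :\ t, (val x).2).
  rewrite /ek_symbol /= (cards_setD1 tx cx); apply/forallP => j; apply/implyP.
  by rewrite !inE => /andP[_ xj]; have := ax j; rewrite xj.
pose G : ek_idx us q.+1 := exist _ ((val x).1 :\ t, (val x).2) hG.
have ta : (t.+1 < max_index (u (val x).2))%N by have := ax t; rewrite tx.
(* Only x contributes to the entry of the boundary at G. *)
have : app (diff EK q.+1) z G = 0 by rewrite zc ffunE.
rewrite (@app_single _ _ _ _ _ _ x).
  rewrite ek_diffE [val x]surjective_pairing ek_entry_face // ek_coef_diag //.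
  by move=> /eqP; rewrite mulf_eq0 (negPf zx) (negPf (signX_neq0 _ _ _)).
move=> y ne zy; apply/eqP/negP => /negP; rewrite ek_diffE => /ek_entry_neq0[w [/= yw xw nz]].
have e : (val y).2 = (val x).2.
  have := ek_coef_leq nz; rewrite leq_eqVlt => /orP[/eqP/val_inj -> //|/ek_rank_gen h].
  by rewrite zlt ?eqxx in zy.
have yE : (val y).1 = w |: (val x).1 :\ t by rewrite xw setD1K.
have wG : w \notin (val x).1 :\ t by rewrite xw !inE eqxx.
have wx : w \notin (val x).1.
  apply: contra ne => wx; apply/eqP/val_inj; move: e yE wG; rewrite !inE wx andbT negbK.
  move=> e yE /eqP wt; rewrite [val y]surjective_pairing [RHS]surjective_pairing e yE wt.
  by rewrite setD1K.
have [tw|wt|/val_inj eq_tw] := ltngtP t w; last by rewrite -eq_tw tx in wx.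
  by rewrite zlt ?eqxx // in zy; apply: ek_rank_set; rewrite // yE set_weight_lt.
have wa : (w.+1 < max_index (u (val x).2))%N.
  by have /andP[_ /forallP/(_ w)] := valP y; rewrite yw e.
have [|t' t'x] := none' w wa; last by rewrite leqNgt (leq_trans wt) // tmin.
have hy := mlead_supp zy; set m' := mlead _ in hy.
have := hz _ _ hy; rewrite -(hz _ _ hm) /= e (big_setD1 w yw) (big_setD1 t tx) /= -xw.
set A := multideg (u _); set B := \sum_(i in _) _.
rewrite !addrA => /addIr; rewrite [_ + A + _]addrAC [in RHS]addrAC => /addIr.
rewrite -!multidegD => /multideg_inj /mnmP /(_ w); rewrite !mnmDE !mnm1E eqxx.
have -> : (t == w) = false by apply/negbTE; rewrite neq_ltn wt orbT.
by rewrite addn0 addn1 => <-.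
Qed.

Lemma ek_lead_complex : lead_complex EK us.
Proof.
split; last by exists ek_rank; exact: ek_lead.
- by exists tt; split=> // -[].
- exact: ek_graded.
- case=> [|[|q]] y; last 2 first.
  + exact/app_app_eq0/ek_dd0.
  + exact/app_app_eq0/ek_dd.
  rewrite /= /aug_ker (@aug_appE _ _ EK tt) //; last by case.
  rewrite ffunE; elim/big_ind: _ => [||x _]; [exact: ideal_gen0|exact: ideal_genD|].
  by apply/ideal_genM/mem_midealX/mem_gens; exists (val x).2; apply: lepm_refl.
Qed.

End Stable.

Theorem proposition1p8 (K : fieldType) (n : nat) :
  (forall us : seq 'X_{1..n},
     has_boundary_gb (taylor K us) (mideal K us)) /\
  (forall (I : {mpoly K[n]} -> Prop) (us : seq 'X_{1..n}) (F : acomplex K n),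
     linear_quotients I us ->
     iterated_cone koszul_choice us F ->
     has_boundary_gb F I) /\
  (forall us : seq 'X_{1..n}, regular_sequence K us ->
     has_boundary_gb (koszul K us) (mideal K us)) /\
  (forall (I : {mpoly K[n]} -> Prop) (us : seq 'X_{1..n}),
     stable I -> minimal_generators I us -> ek_ordered us ->
     has_boundary_gb (eliahou_kervaire K us) I).
Proof.
split; [|split; [|split]].
- by move=> us; apply/lead_complex_boundary/taylor_lead_complex.
- move=> I us F [/same_ideal_eq -> _ _] /iterated_cone_lead_complex.
  exact: lead_complex_boundary.
- move=> us /regular_coprime/koszul_taylor ->.
  exact/lead_complex_boundary/taylor_lead_complex.
- move=> I us st [/same_ideal_eq IE us_min] us_ord; rewrite IE in st *.
  exact/lead_complex_boundary/ek_lead_complex.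
Qed.
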